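(* Let $\varphi:\overline{\mathbb{D}}\to\overline{\mathbb{D}}$, $\varphi\in A(\mathbb{D})$, be a symbol whose Denjoy-Wolff point $z_0$ lies in the open disc $\mathbb{D}$. Let $C_\varphi:A(\mathbb{D})\to A(\mathbb{D})$, $C_\varphi f=f\circ\varphi$. The following are equivalent: (i) $C_\varphi$ is mean ergodic on $A(\mathbb{D})$; (ii) $C_\varphi$ is uniformly mean ergodic on $A(\mathbb{D})$; (iii) $\lim_{n}\varphi^n(z)=z_0$ for every $z\in\overline{\mathbb{D}}$.
   Context: $\mathbb{D}$ is the open unit disc in $\mathbb{C}$. $A(\mathbb{D})$ is the disc algebra: the Banach space of functions continuous on $\overline{\mathbb{D}}$ and holomorphic on $\mathbb{D}$, with the sup norm. A symbol is a holomorphic map $\varphi$ with $\varphi(\mathbb{D})\subseteq\mathbb{D}$. $\varphi^n=\varphi\circ\cdots\circ\varphi$ ($n$ times). If a symbol $\varphi$ is neither the identity nor an automorphism of $\mathbb{D}$ with exactly one fixed point in $\mathbb{D}$, the Denjoy-Wolff theorem gives a unique point $z_0\in\overline{\mathbb{D}}$, the Denjoy-Wolff point of $\varphi$, such that $\varphi^n\to z_0$ uniformly on compact subsets of $\mathbb{D}$; a symbol ''with Denjoy-Wolff point'' is one of this kind. A bounded operator $T$ on a Banach space $X$ is mean ergodic if $T_{[n]}=\frac1n\sum_{m=1}^nT^m$ converges in the strong operator topology to some bounded operator on $X$, and uniformly mean ergodic if it converges in operator norm. *)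

(* Defs.v *)
From Stdlib Require Import Reals Lra Lia List.
From Stdlib Require Import FunctionalExtensionality ProofIrrelevance ClassicalEpsilon.
From Coquelicot Require Import Coquelicot.

Open Scope R_scope.

Definition open_disc (z : C) : Prop := Cmod z < 1.
Definition closed_disc (z : C) : Prop := Cmod z <= 1.

Definition holomorphic_on (D : C -> Prop) (f : C -> C) : Prop :=
  forall z, D z -> ex_derive (K := C_AbsRing) (V := C_NormedModule) f z.

(* Functions on the closed disc are represented by their extension by zero to
   the plane, so that equality in [disc_algebra] is equality on the closed disc;
   continuity is required relative to the closed disc only. *)
Record disc_algebra : Type := mk_disc_algebra {
  da_fun :> C -> C;
  da_continuous :
    continuous_on (T := C_UniformSpace) (U := C_UniformSpace) closed_disc da_fun;
  da_holomorphic : holomorphic_on open_disc da_fun;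
  da_outside : forall z, ~ closed_disc z -> da_fun z = 0%C
}.

(* The supremum is finite on [disc_algebra], see [sup_norm_lub]. *)
Definition sup_norm (f : C -> C) : R :=
  real (Lub_Rbar (fun r => exists z, closed_disc z /\ r = Cmod (f z))).

Lemma disc_algebra_ext (f g : disc_algebra) :
  (forall z, closed_disc z -> f z = g z) -> f = g.
Proof.
  intros H.
  assert (E : da_fun f = da_fun g).
  { apply functional_extensionality; intros z.
    destruct (classic (closed_disc z)) as [Hz|Hz]; [now apply H|].
    now rewrite (da_outside f z Hz), (da_outside g z Hz). }
  destruct f as [f f1 f2 f3], g as [g g1 g2 g3]; simpl in E; subst g.
  f_equal; apply proof_irrelevance.
Qed.

Lemma open_disc_closed z : open_disc z -> closed_disc z.
Proof. unfold open_disc, closed_disc; lra. Qed.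

Lemma da_bounded (f : disc_algebra) :
  exists M, forall z, closed_disc z -> Cmod (f z) <= M.
Proof.
  assert (Hloc : forall t : C, exists dM : posreal * R, forall x : C,
    Rabs (fst x - fst t) < fst dM -> Rabs (snd x - snd t) < fst dM ->
    closed_disc x -> Cmod (f x) <= snd dM).
  { intros t. destruct (Rle_lt_dec (Cmod t) 1) as [Ht|Ht].
    - pose proof (da_continuous f t Ht) as Hc.
      assert (Hl : locally (T := C_UniformSpace) (f t)
                     (fun y => Cmod (minus (G := C_NormedModule) y (f t)) < sqrt 2 * 1)).
      { exists (mkposreal 1 Rlt_0_1). intros y Hy.
        exact (C_NormedModule_mixin_compat2 _ _ (mkposreal 1 Rlt_0_1) Hy). }
      specialize (Hc _ Hl). destruct Hc as [d Hd].
      exists (d, Cmod (f t) + sqrt 2). simpl. intros x H1 H2 Hx.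
      assert (Hb : ball (M := C_UniformSpace) t d x) by (split; assumption).
      specialize (Hd x Hb Hx). simpl in Hd.
      replace (f x) with (Cplus (f t) (Cplus (f x) (Copp (f t)))) by ring.
      eapply Rle_trans; [apply Cmod_triangle|].
      change (Cmod (Cplus (f x) (Copp (f t))) < sqrt 2 * 1) in Hd. lra.
    - assert (Hp : 0 < (Cmod t - 1) / 2) by lra.
      exists (mkposreal _ Hp, 0). simpl. intros x H1 H2 Hx. exfalso.
      assert (Hb : ball (M := C_UniformSpace) t (mkposreal _ Hp) x)
        by (split; assumption).
      apply C_NormedModule_mixin_compat2 in Hb. simpl in Hb.
      change (Cmod (Cplus x (Copp t)) < sqrt 2 * ((Cmod t - 1) / 2)) in Hb.
      assert (sqrt 2 < 2).
      { rewrite <- (sqrt_Rsqr 2) at 2 by lra. apply sqrt_lt_1; unfold Rsqr; lra. }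
      assert (Ht' : Cmod t <= Cmod x + Cmod (Cplus x (Copp t))).
      { replace t with (Cplus x (Copp (Cplus x (Copp t)))) at 1 by ring.
        eapply Rle_trans; [apply Cmod_triangle|]. rewrite Cmod_opp. lra. }
      unfold closed_disc in Hx. nra. }
  pose (pt := fun t : Compactness.Tn 2 R => (fst t, fst (snd t)) : C).
  pose (ch := fun t => proj1_sig (constructive_indefinite_description _ (Hloc t))).
  assert (Hch : forall t x : C,
    Rabs (fst x - fst t) < fst (ch t) -> Rabs (snd x - snd t) < fst (ch t) ->
    closed_disc x -> Cmod (f x) <= snd (ch t)).
  { intros t. exact (proj2_sig (constructive_indefinite_description _ (Hloc t))). }
  apply NNPP; intros Hno.
  apply (compactness_list 2 (-1, (-1, tt)) (1, (1, tt)) (fun t => fst (ch (pt t)))).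
  intros [l Hl]. apply Hno.
  exists (fold_right Rmax 0 (map (fun t => snd (ch (pt t))) l)).
  intros z Hz.
  pose proof (Rmax_Cmod z) as Hm. unfold closed_disc in Hz.
  pose proof (Rmax_l (Rabs (fst z)) (Rabs (snd z))).
  pose proof (Rmax_r (Rabs (fst z)) (Rabs (snd z))).
  assert (H1 : -1 <= fst z <= 1) by (apply Rabs_le_between; lra).
  assert (H2 : -1 <= snd z <= 1) by (apply Rabs_le_between; lra).
  destruct (Hl (fst z, (snd z, tt))) as [t [Ht [_ Hc]]]; [simpl; tauto|].
  destruct t as [t1 [t2 []]]. simpl in Hc.
  apply Rle_trans with (snd (ch (pt (t1, (t2, tt))))).
  - now apply Hch.
  - clear - Ht. induction l as [|a l IH]; [easy|]. simpl. destruct Ht as [->|Ht].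
    + apply Rmax_l.
    + eapply Rle_trans; [now apply IH | apply Rmax_r].
Qed.

Lemma closed_disc_0 : closed_disc 0%C.
Proof. unfold closed_disc; rewrite Cmod_0; lra. Qed.

Lemma sup_norm_lub (f : disc_algebra) :
  is_lub_Rbar (fun r => exists z, closed_disc z /\ r = Cmod (f z)) (sup_norm f).
Proof.
  unfold sup_norm.
  set (S := fun r => exists z, closed_disc z /\ r = Cmod (f z)).
  pose proof (Lub_Rbar_correct S) as HL.
  destruct (da_bounded f) as [M HM].
  destruct (Lub_Rbar S) as [r| |]; [exact HL| |]; exfalso.
  - apply (proj2 HL (Finite M)). intros x [z [Hz ->]]. now apply HM.
  - apply (proj1 HL (Cmod (f 0%C))). exists 0%C. split; [apply closed_disc_0|easy].
Qed.

Lemma Cmod_le_sup_norm (f : disc_algebra) z : closed_disc z -> Cmod (f z) <= sup_norm f.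
Proof. intros Hz. apply (proj1 (sup_norm_lub f)). now exists z. Qed.

Lemma sup_norm_le (f : disc_algebra) M :
  (forall z, closed_disc z -> Cmod (f z) <= M) -> sup_norm f <= M.
Proof.
  intros H. apply (proj2 (sup_norm_lub f) (Finite M)).
  intros x [z [Hz ->]]. now apply H.
Qed.

Definition da_zero : disc_algebra.
Proof.
  refine (mk_disc_algebra (fun _ => 0%C) _ _ _).
  - intros z _. apply filterlim_const.
  - intros z _. apply (ex_derive_const (K := C_AbsRing) (V := C_NormedModule)).
  - easy.
Defined.

Definition da_plus (f g : disc_algebra) : disc_algebra.
Proof.
  refine (mk_disc_algebra (fun z => Cplus (f z) (g z)) _ _ _).
  - intros z Hz.
    exact (filterlim_comp_2 f g (plus (G := C_NormedModule)) (da_continuous f z Hz)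
             (da_continuous g z Hz) (filterlim_plus (V := C_NormedModule) (f z) (g z))).
  - intros z Hz.
    exact (ex_derive_plus (K := C_AbsRing) (V := C_NormedModule) f g z
             (da_holomorphic f z Hz) (da_holomorphic g z Hz)).
  - intros z Hz. rewrite (da_outside f z Hz), (da_outside g z Hz). apply Cplus_0_l.
Defined.

Lemma holomorphic_scal (k : C) (f : C -> C) z :
  ex_derive (K := C_AbsRing) (V := C_NormedModule) f z ->
  ex_derive (K := C_AbsRing) (V := C_NormedModule) (fun x => Cmult k (f x)) z.
Proof.
  intros [l Hl]. exists (Cmult k l).
  apply (filterdiff_ext_lin (K := C_AbsRing) (U := AbsRing_NormedModule C_AbsRing)
           (V := C_NormedModule) _
           (fun y => scal (V := C_NormedModule) k (scal (V := C_NormedModule) y l))).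
  - exact (filterdiff_scal_r_fct (K := C_AbsRing) (U := AbsRing_NormedModule C_AbsRing)
             (V := C_NormedModule) k f _ Cmult_comm Hl).
  - intros y.
    change (Cmult k (Cmult y l) = Cmult y (Cmult k l)). ring.
Qed.

Definition da_scal (k : C) (f : disc_algebra) : disc_algebra.
Proof.
  refine (mk_disc_algebra (fun z => Cmult k (f z)) _ _ _).
  - intros z Hz.
    exact (filterlim_comp _ _ _ f (scal (V := C_NormedModule) k) _ _ _
             (da_continuous f z Hz) (filterlim_scal_r (V := C_NormedModule) k (f z))).
  - intros z Hz. apply holomorphic_scal, (da_holomorphic f z Hz).
  - intros z Hz. rewrite (da_outside f z Hz). apply Cmult_0_r.
Defined.

Definition da_opp (f : disc_algebra) : disc_algebra := da_scal (-1) f.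

Definition da_AbelianMonoid_mixin : AbelianMonoid.mixin_of disc_algebra.
Proof.
  refine (AbelianMonoid.Mixin _ da_plus da_zero _ _ _); intros; apply disc_algebra_ext; intros; simpl; ring.
Defined.

Canonical da_AbelianMonoid :=
  AbelianMonoid.Pack disc_algebra da_AbelianMonoid_mixin disc_algebra.

Definition da_AbelianGroup_mixin : AbelianGroup.mixin_of da_AbelianMonoid.
Proof.
  refine (AbelianGroup.Mixin _ da_opp _); intros f; apply disc_algebra_ext; intros; simpl; ring.
Defined.

Canonical da_AbelianGroup :=
  AbelianGroup.Pack disc_algebra
    (AbelianGroup.Class _ da_AbelianMonoid_mixin da_AbelianGroup_mixin) disc_algebra.

Definition da_ModuleSpace_mixin : ModuleSpace.mixin_of C_Ring da_AbelianGroup.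
Proof.
  refine (ModuleSpace.Mixin _ _ da_scal _ _ _ _); intros; apply disc_algebra_ext; intros; simpl.
  - apply Cmult_assoc.
  - apply Cmult_1_l.
  - apply Cmult_plus_distr_l.
  - apply Cmult_plus_distr_r.
Defined.

Canonical da_ModuleSpace :=
  ModuleSpace.Pack C_Ring disc_algebra
    (ModuleSpace.Class _ _ (AbelianGroup.class da_AbelianGroup) da_ModuleSpace_mixin)
    disc_algebra.

Definition da_ball (f : disc_algebra) (e : R) (g : disc_algebra) : Prop :=
  sup_norm (minus g f) < e.

Lemma sup_norm_triangle (f g : disc_algebra) :
  sup_norm (da_plus f g) <= sup_norm f + sup_norm g.
Proof.
  apply sup_norm_le; intros z Hz; simpl.
  eapply Rle_trans; [apply Cmod_triangle|].
  apply Rplus_le_compat; now apply Cmod_le_sup_norm.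
Qed.

Lemma sup_norm_scal (k : C) (f : disc_algebra) :
  sup_norm (da_scal k f) <= Cmod k * sup_norm f.
Proof.
  apply sup_norm_le; intros z Hz; simpl. rewrite Cmod_mult.
  apply Rmult_le_compat_l; [apply Cmod_ge_0 | now apply Cmod_le_sup_norm].
Qed.

Lemma sup_norm_0 : sup_norm da_zero <= 0.
Proof. apply sup_norm_le; intros z Hz; simpl. rewrite Cmod_0. lra. Qed.

Lemma sup_norm_eq_0 (f : disc_algebra) : sup_norm f = 0 -> f = da_zero.
Proof.
  intros H; apply disc_algebra_ext; intros z Hz; simpl.
  apply Cmod_eq_0, Rle_antisym; [|apply Cmod_ge_0].
  rewrite <- H. now apply Cmod_le_sup_norm.
Qed.

Definition da_UniformSpace_mixin : UniformSpace.mixin_of disc_algebra.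
Proof.
  refine (UniformSpace.Mixin _ da_zero da_ball _ _ _); unfold da_ball.
  - intros f e. replace (minus f f) 
      with da_zero by (symmetry; exact (minus_eq_zero (G := da_AbelianGroup) f)).
    apply Rle_lt_trans with (1 := sup_norm_0), cond_pos.
  - intros f g e H. apply Rle_lt_trans with (2 := H).
    apply sup_norm_le; intros z Hz.
    eapply Rle_trans; [|exact (Cmod_le_sup_norm (minus g f) z Hz)].
    rewrite <- Cmod_opp. apply Req_le; f_equal; simpl; ring.
  - intros f g h e1 e2 H1 H2.
    eapply Rle_lt_trans; [|exact (Rplus_lt_compat _ _ _ _ H1 H2)].
    eapply Rle_trans; [|apply sup_norm_triangle].
    apply Req_le; f_equal.
    apply functional_extensionality; intros z; simpl; ring.
Defined.

Canonical da_UniformSpace :=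
  UniformSpace.Pack disc_algebra da_UniformSpace_mixin disc_algebra.

Canonical da_NormedModuleAux :=
  NormedModuleAux.Pack C_AbsRing disc_algebra
    (NormedModuleAux.Class C_AbsRing disc_algebra
       (ModuleSpace.class C_Ring da_ModuleSpace) da_UniformSpace_mixin)
    disc_algebra.

Definition da_NormedModule_mixin : NormedModule.mixin_of C_AbsRing da_NormedModuleAux.
Proof.
  refine (NormedModule.Mixin _ _ (fun f : disc_algebra => sup_norm f) 1 _ _ _ _ _).
  - exact sup_norm_triangle.
  - exact sup_norm_scal.
  - intros f g e H; exact H.
  - intros f g e H; rewrite Rmult_1_l; exact H.
  - exact sup_norm_eq_0.
Defined.

Canonical da_NormedModule :=
  NormedModule.Pack C_AbsRing disc_algebra
    (NormedModule.Class C_AbsRing disc_algebra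
       (NormedModuleAux.class C_AbsRing da_NormedModuleAux) da_NormedModule_mixin)
    disc_algebra.

Record bounded_operator (X : NormedModule C_AbsRing) : Type := mk_bounded_operator {
  op_fun :> X -> X;
  op_bounded : is_linear op_fun
}.
Arguments mk_bounded_operator {X}.

(* The mean of T, ..., T^n, for n >= 1; the value at n = 0 is irrelevant to limits. *)
Definition cesaro_mean {X : NormedModule C_AbsRing} (T : bounded_operator X)
    (n : nat) (x : X) : X :=
  scal (RtoC (/ INR n) : C_AbsRing) (sum_n_m (fun m => Nat.iter m T x) 1 n).

Definition op_norm {X : NormedModule C_AbsRing} (T : X -> X) : Rbar :=
  Lub_Rbar (fun r => exists x : X, norm x <= 1 /\ r = norm (T x)).

Definition mean_ergodic {X : NormedModule C_AbsRing} (T : bounded_operator X) : Prop :=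
  exists P : bounded_operator X, forall x : X,
    filterlim (fun n => cesaro_mean T n x) eventually (locally (P x)).

Definition uniformly_mean_ergodic {X : NormedModule C_AbsRing}
    (T : bounded_operator X) : Prop :=
  exists P : bounded_operator X, forall eps : posreal,
    eventually (fun n =>
      Rbar_lt (op_norm (fun x => minus (cesaro_mean T n x) (P x))) eps).

Definition symbol (phi : C -> C) : Prop :=
  holomorphic_on open_disc phi /\ forall z, open_disc z -> open_disc (phi z).

Definition disc_automorphism (phi : C -> C) : Prop :=
  symbol phi /\
  exists psi : C -> C, symbol psi /\
    forall z, open_disc z -> psi (phi z) = z /\ phi (psi z) = z.

Definition compact_set {T : UniformSpace} (K : T -> Prop) : Prop :=
  forall F : (T -> Prop) -> Prop,
    (forall U, F U -> open U) ->
    (forall x, K x -> exists U, F U /\ U x) ->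
    exists l : list (T -> Prop),
      (forall U, In U l -> F U) /\ (forall x, K x -> exists U, In U l /\ U x).

(* The iterates converge to z0 for a symbol that is neither the identity nor an
   automorphism with exactly one fixed point in the disc. *)
Definition Denjoy_Wolff_point (phi : C -> C) (z0 : C) : Prop :=
  symbol phi /\
  ~ (forall z, open_disc z -> phi z = z) /\
  ~ (disc_automorphism phi /\ exists! w, open_disc w /\ phi w = w) /\
  closed_disc z0 /\
  forall K : C -> Prop,
    compact_set (T := C_UniformSpace) K -> (forall z, K z -> open_disc z) ->
    forall eps : posreal,
      eventually (fun n => forall z, K z -> Cmod (Nat.iter n phi z - z0) < eps).

Lemma holomorphic_comp (f g : C -> C) z :
  ex_derive (K := C_AbsRing) (V := C_NormedModule) f (g z) ->
  ex_derive (K := C_AbsRing) (V := C_NormedModule) g z ->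
  ex_derive (K := C_AbsRing) (V := C_NormedModule) (fun x => f (g x)) z.
Proof.
  intros Hf [l [Hl1 Hl2]].
  apply (ex_derive_comp (K := C_AbsRing) (V := C_NormedModule) f g z Hf).
  exists l; split; [|exact Hl2].
  destruct Hl1 as [h1 h2 h3]; split; [exact h1|exact h2|exact h3].
Qed.

Lemma closed_disc_nbhs (z : C) :
  open_disc z ->
  locally (T := AbsRing_UniformSpace C_AbsRing) z closed_disc.
Proof.
  intros Hz. unfold open_disc in Hz.
  assert (Hp : 0 < 1 - Cmod z) by lra.
  exists (mkposreal _ Hp). intros y Hy.
  change (Cmod (Cplus y (Copp z)) < 1 - Cmod z) in Hy.
  unfold closed_disc.
  replace y with (Cplus z (Cplus y (Copp z))) by ring.
  eapply Rle_trans; [apply Cmod_triangle|]. lra.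
Qed.

Definition da_comp (phi : disc_algebra)
    (Hc : forall z, closed_disc z -> closed_disc (phi z))
    (Ho : forall z, open_disc z -> open_disc (phi z))
    (f : disc_algebra) : disc_algebra.
Proof.
  refine (mk_disc_algebra
    (fun z => if Rle_dec (Cmod z) 1 then f (phi z) else 0%C) _ _ _).
  - intros z Hz. destruct (Rle_dec (Cmod z) 1) as [_|n]; [|now destruct n].
    apply filterlim_within_ext with (f := fun x => f (phi x)).
    { intros x Hx. destruct (Rle_dec (Cmod x) 1) as [_|n]; [easy|now destruct n]. }
    apply filterlim_comp with
      (G := within closed_disc (locally (T := C_UniformSpace) (phi z))).
    + intros P HP. unfold filtermap, within in *.
      pose proof (da_continuous phi z Hz _ HP) as H.
      unfold filtermap, within in H.
      revert H; apply filter_imp; intros x H Hx. apply H; auto.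
    + apply da_continuous. now apply Hc.
  - intros z Hz.
    apply ex_derive_ext_loc with (f := fun x => f (phi x)).
    + generalize (closed_disc_nbhs z Hz); apply filter_imp.
      intros x Hx. destruct (Rle_dec (Cmod x) 1) as [_|n]; [easy|now destruct n].
    + apply holomorphic_comp; apply da_holomorphic; auto.
  - intros z Hz. destruct (Rle_dec (Cmod z) 1) as [H|_]; [now destruct Hz|easy].
Defined.

Lemma da_comp_linear phi Hc Ho :
  is_linear (K := C_AbsRing) (U := da_NormedModule) (V := da_NormedModule)
    (da_comp phi Hc Ho).
Proof.
  split.
  - intros f g; apply disc_algebra_ext; intros z Hz; simpl.
    destruct (Rle_dec (Cmod z) 1); [easy|ring].
  - intros k f; apply disc_algebra_ext; intros z Hz; simpl.
    destruct (Rle_dec (Cmod z) 1); [easy|ring].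
  - exists 1; split; [lra|]. intros f. rewrite Rmult_1_l.
    apply (sup_norm_le (da_comp phi Hc Ho f)); intros z Hz; simpl.
    destruct (Rle_dec (Cmod z) 1) as [_|n]; [|now destruct n].
    now apply Cmod_le_sup_norm, Hc.
Qed.

Definition composition_operator (phi : disc_algebra)
    (Hc : forall z, closed_disc z -> closed_disc (phi z))
    (Ho : forall z, open_disc z -> open_disc (phi z)) :
    bounded_operator da_NormedModule :=
  mk_bounded_operator (da_comp phi Hc Ho : da_NormedModule -> da_NormedModule)
    (da_comp_linear phi Hc Ho).

(* Main.v *)
(** (i) => (iii). The means of [f o phi^m] converge on the open disc to [f z0], hence,
    the limit being continuous, on the whole closed disc. Suppose that some orbit
    stays on the unit circle. If [|phi w| < 1] for some [w] on the circle, that orbit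
    avoids an arc around [w], and testing with a Poisson-type function concentrated
    on this arc contradicts the convergence. Otherwise [phi] preserves the circle and
    has a fixed point [w] on it, and testing with [f z = z] gives [w = z0]. The fixed
    point exists because otherwise, with [psi] the conjugate of [phi] fixing [0],
    [G x = x / (x - psi x)] has real part [1/2] on the circle while its value at the
    centre, [1 / (1 - phi'(z0))], has a larger real part since [|phi'(z0)| < 1].

    (iii) => (ii). By compactness [phi^n -> z0] uniformly on the closed disc, and the
    unit ball of the disc algebra is uniformly Lipschitz near [z0].

    The complex analysis needed reduces to one fact: if [G] is holomorphic on the
    punctured disc with a limit at [0], an upper bound for [Re G] on a circle
    [|z| = r] is an upper bound for [Re] of the limit. In logarithmic polar coordinates
    this is Goursat's bisection argument for the field [(Re G, - Im G)], which only
    needs pointwise differentiability. *)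
Require Import Defs.
From Stdlib Require Import Reals Lra Lia List ClassicalEpsilon.
From Coquelicot Require Import Coquelicot.
Open Scope R_scope.

(** * Goursat's lemma for real planar fields *)

(** The outward flux of the field [(P, Q)] through the boundary of the rectangle with corner
    [(a, c)] and sides [h], [k]. Opposite sides share one integral, so that an affine field gives
    constant integrands. *)
Definition flux (P Q : R -> R -> R) (a c h k : R) : R :=
  RInt (fun y => P (a + h) y - P a y) c (c + k)
  + RInt (fun x => Q x (c + k) - Q x c) a (a + h).

Lemma differentiable_continuous_1 (f : R -> R -> R) x y lx ly :
  differentiable_pt_lim f x y lx ly -> continuous (fun u => f u y) x.
Proof.
  intros H. apply continuity_pt_filterlim, derivable_continuous_pt.
  exists (lx * 1 + ly * 0).
  apply (derivable_pt_lim_comp_2d f (fun u => u) (fun _ => y) x lx ly 1 0 H).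
  - apply derivable_pt_lim_id.
  - apply derivable_pt_lim_const.
Qed.

Lemma differentiable_continuous_2 (f : R -> R -> R) x y lx ly :
  differentiable_pt_lim f x y lx ly -> continuous (fun v => f x v) y.
Proof.
  intros H. apply continuity_pt_filterlim, derivable_continuous_pt.
  exists (lx * 0 + ly * 1).
  apply (derivable_pt_lim_comp_2d f (fun _ => x) (fun v => v) y lx ly 0 1 H).
  - apply derivable_pt_lim_const.
  - apply derivable_pt_lim_id.
Qed.

Section Green.
Variables (P Q : R -> R -> R) (X : R).
(** The divergence vanishes at each point of a half-plane, while the partial derivatives may be
    discontinuous. In the application [X] is 0 and the half-plane covers the punctured unit disc in
    logarithmic polar coordinates. *)
Hypothesis PQ : forall x y, x < X -> exists px py qx,
  differentiable_pt_lim P x y px py /\ differentiable_pt_lim Q x y qx (- px).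

Lemma ex_RInt_vertical x c d : x < X -> ex_RInt (P x) c d.
Proof.
  intros Hx. apply (ex_RInt_continuous (V := R_CompleteNormedModule)). intros y _.
  destruct (PQ x y Hx) as (px & py & qx & H & _).
  exact (differentiable_continuous_2 P x y px py H).
Qed.

Lemma ex_RInt_horizontal y a b :
  a < X -> b < X -> ex_RInt (fun x => Q x y) a b.
Proof.
  intros Ha Hb. apply (ex_RInt_continuous (V := R_CompleteNormedModule)). intros x Hx.
  assert (Hx' : x < X).
  { apply Rle_lt_trans with (1 := proj2 Hx). now apply Rmax_case. }
  destruct (PQ x y Hx') as (px & py & qx & _ & H).
  exact (differentiable_continuous_1 Q x y qx (- px) H).
Qed.

Lemma flux_eq a c h k : a < X -> a + h < X ->
  flux P Q a c h k =
  RInt (P (a + h)) c (c + k) - RInt (P a) c (c + k)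
  + (RInt (fun x => Q x (c + k)) a (a + h) - RInt (fun x => Q x c) a (a + h)).
Proof.
  intros Ha Hb. unfold flux. f_equal.
  - exact (RInt_minus (V := R_CompleteNormedModule) (P (a + h)) (P a) c (c + k)
      (ex_RInt_vertical _ _ _ Hb) (ex_RInt_vertical _ _ _ Ha)).
  - exact (RInt_minus (V := R_CompleteNormedModule) (fun x => Q x (c + k)) (fun x => Q x c) a (a + h)
      (ex_RInt_horizontal _ _ _ Ha Hb) (ex_RInt_horizontal _ _ _ Ha Hb)).
Qed.

Lemma flux_split_1 a c h1 h2 k : a < X -> a + h1 < X -> a + h1 + h2 < X ->
  flux P Q a c (h1 + h2) k = flux P Q a c h1 k + flux P Q (a + h1) c h2 k.
Proof.
  intros Ha Hb Hc. rewrite !flux_eq by lra.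
  rewrite <- (Rplus_assoc a h1 h2).
  assert (E : forall y, RInt (fun x => Q x y) a (a + h1 + h2) =
    RInt (fun x => Q x y) a (a + h1) + RInt (fun x => Q x y) (a + h1) (a + h1 + h2)).
  { intros y. symmetry. apply (RInt_Chasles (fun x => Q x y)); now apply ex_RInt_horizontal. }
  rewrite !E. lra.
Qed.

Lemma flux_split_2 a c h k1 k2 : a < X -> a + h < X ->
  flux P Q a c h (k1 + k2) = flux P Q a c h k1 + flux P Q a (c + k1) h k2.
Proof.
  intros Ha Hb. rewrite !flux_eq by lra.
  rewrite <- (Rplus_assoc c k1 k2).
  assert (E : forall x, x < X -> RInt (P x) c (c + k1 + k2) =
    RInt (P x) c (c + k1) + RInt (P x) (c + k1) (c + k1 + k2)).
  { intros x Hx. symmetry. apply (RInt_Chasles (P x)); now apply ex_RInt_vertical. }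
  rewrite !E by assumption. lra.
Qed.

(* The linear parts of [P] and [Q] at [(x, y)] contribute nothing since [P_x + Q_y = 0]. *)
Lemma flux_small x y : x < X -> forall eps, 0 < eps -> exists delta, 0 < delta /\
  forall a c h k, 0 <= h < delta -> 0 <= k < delta ->
    a <= x <= a + h -> c <= y <= c + k -> a + h < X ->
    Rabs (flux P Q a c h k) <= eps * ((h + k) * (h + k)).
Proof.
  intros Hx eps Heps. destruct (PQ x y Hx) as (px & py & qx & HP & HQ).
  (* Half of [eps], because each integrand is a difference of two values, both within
     [eps / 2 * (h + k)] of their linear parts. Integrating over lengths [k] and [h] then gives
     [eps] times the square of [h + k]. *)
  assert (He : 0 < eps / 2) by lra.
  destruct (HP (mkposreal _ He)) as [d1 H1].
  destruct (HQ (mkposreal _ He)) as [d2 H2]. simpl in H1, H2.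
  exists (Rmin d1 d2). split.
  { apply Rmin_case; apply cond_pos. }
  intros a c h k Hh Hk Ha Hc HX.
  assert (Hd1 := Rmin_l d1 d2). assert (Hd2 := Rmin_r d1 d2).
  assert (Hm : forall u v, a <= u <= a + h -> c <= v <= c + k ->
     Rabs (u - x) < Rmin d1 d2 /\ Rabs (v - y) < Rmin d1 d2 /\
     Rmax (Rabs (u - x)) (Rabs (v - y)) <= h + k).
  { intros u v Hu Hv.
    assert (Rabs (u - x) <= h) by (apply Rabs_le; lra).
    assert (Rabs (v - y) <= k) by (apply Rabs_le; lra).
    split; [lra|]. split; [lra|]. apply Rmax_lub; lra. }
  assert (BP : forall u v, a <= u <= a + h -> c <= v <= c + k ->
     Rabs (P u v - P x y - (px * (u - x) + py * (v - y))) <= eps / 2 * (h + k)).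
  { intros u v Hu Hv. destruct (Hm u v Hu Hv) as (M1 & M2 & M3).
    eapply Rle_trans; [apply H1; lra|]. apply Rmult_le_compat_l; lra. }
  assert (BQ : forall u v, a <= u <= a + h -> c <= v <= c + k ->
     Rabs (Q u v - Q x y - (qx * (u - x) + - px * (v - y))) <= eps / 2 * (h + k)).
  { intros u v Hu Hv. destruct (Hm u v Hu Hv) as (M1 & M2 & M3).
    eapply Rle_trans; [apply H2; lra|]. apply Rmult_le_compat_l; lra. }
  assert (Ha' : a < X) by lra.
  assert (EP : ex_RInt (fun v => P (a + h) v - P a v) c (c + k)).
  { apply (ex_RInt_minus (V := R_NormedModule)); now apply ex_RInt_vertical. }
  assert (EQ : ex_RInt (fun u => Q u (c + k) - Q u c) a (a + h)).
  { apply (ex_RInt_minus (V := R_NormedModule)); now apply ex_RInt_horizontal. }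
  assert (IP : Rabs (RInt (fun v => P (a + h) v - P a v - px * h) c (c + k))
               <= (c + k - c) * (eps * (h + k))).
  { apply abs_RInt_le_const; [lra| |].
    - apply (ex_RInt_minus (V := R_NormedModule)); [exact EP|apply ex_RInt_const].
    - intros v Hv.
      assert (B1 := BP (a + h) v ltac:(lra) Hv). assert (B2 := BP a v ltac:(lra) Hv).
      apply Rabs_le_between in B1. apply Rabs_le_between in B2.
      apply Rabs_le. lra. }
  assert (IQ : Rabs (RInt (fun u => Q u (c + k) - Q u c - - px * k) a (a + h))
               <= (a + h - a) * (eps * (h + k))).
  { apply abs_RInt_le_const; [lra| |].
    - apply (ex_RInt_minus (V := R_NormedModule)); [exact EQ|apply ex_RInt_const].
    - intros u Hu.
      assert (B1 := BQ u (c + k) Hu ltac:(lra)). assert (B2 := BQ u c Hu ltac:(lra)).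
      apply Rabs_le_between in B1. apply Rabs_le_between in B2.
      apply Rabs_le. lra. }
  assert (JP : RInt (fun v => P (a + h) v - P a v - px * h) c (c + k) =
     RInt (fun v => P (a + h) v - P a v) c (c + k) - k * (px * h)).
  { eapply eq_trans.
    - apply (RInt_minus (V := R_CompleteNormedModule)); [exact EP|apply ex_RInt_const].
    - rewrite RInt_const. change scal with Rmult. unfold minus, plus, opp; simpl. ring. }
  assert (JQ : RInt (fun u => Q u (c + k) - Q u c - - px * k) a (a + h) =
     RInt (fun u => Q u (c + k) - Q u c) a (a + h) - h * (- px * k)).
  { eapply eq_trans.
    - apply (RInt_minus (V := R_CompleteNormedModule)); [exact EQ|apply ex_RInt_const].
    - rewrite RInt_const. change scal with Rmult. unfold minus, plus, opp; simpl. ring. }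
  rewrite JP in IP. rewrite JQ in IQ. unfold flux.
  apply Rabs_le_between in IP. apply Rabs_le_between in IQ. apply Rabs_le. lra.
Qed.

Definition large (eps a c h k : R) : Prop := eps * (h * k) < Rabs (flux P Q a c h k).

(** The flux is additive over the four quarters, so they cannot all be below a quarter of the
    threshold. The quarter is returned as data, found by deciding inequalities, since the bisection
    iterates this choice in a recursive definition. *)
Lemma large_quarter eps a c h k :
  0 < h -> a + h < X -> large eps a c h k ->
  { p : R * R | (fst p = a \/ fst p = a + h / 2) /\ (snd p = c \/ snd p = c + k / 2) /\
    large eps (fst p) (snd p) (h / 2) (k / 2) }.
Proof.
  unfold large. intros Hh HX H.
  destruct (Rlt_dec (eps * (h / 2 * (k / 2))) (Rabs (flux P Q a c (h / 2) (k / 2)))) as [|n1].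
  { exists (a, c). simpl. auto. }
  destruct (Rlt_dec (eps * (h / 2 * (k / 2))) (Rabs (flux P Q (a + h / 2) c (h / 2) (k / 2)))) as [|n2].
  { exists (a + h / 2, c). simpl. auto. }
  destruct (Rlt_dec (eps * (h / 2 * (k / 2))) (Rabs (flux P Q a (c + k / 2) (h / 2) (k / 2)))) as [|n3].
  { exists (a, c + k / 2). simpl. auto. }
  destruct (Rlt_dec (eps * (h / 2 * (k / 2))) (Rabs (flux P Q (a + h / 2) (c + k / 2) (h / 2) (k / 2)))) as [|n4].
  { exists (a + h / 2, c + k / 2). simpl. auto. }
  exfalso. apply Rnot_lt_le in n1, n2, n3, n4.
  assert (E : flux P Q a c h k = flux P Q a c (h / 2 + h / 2) (k / 2 + k / 2)) by (f_equal; lra).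
  rewrite E in H. rewrite flux_split_1, !flux_split_2 in H by lra.
  revert H. apply Rle_not_lt.
  apply Rabs_le_between in n1, n2, n3, n4. apply Rabs_le. lra.
Qed.

(** Goursat's argument: a nonzero flux would persist, relative to area, in a nested sequence of
    quarters shrinking to a point, where [flux_small] forbids it. *)
Lemma flux_zero a c h k : 0 < h -> 0 < k -> a + h < X -> flux P Q a c h k = 0.
Proof.
  intros Hh Hk HX.
  destruct (Req_dec (flux P Q a c h k) 0) as [|Hne]; [assumption|exfalso].
  assert (Hhk : 0 < h * k) by now apply Rmult_lt_0_compat.
  (* Half the flux per unit area, so that the initial rectangle is strictly [large]. *)
  set (eps := Rabs (flux P Q a c h k) / (h * k) / 2).
  assert (Hpos : 0 < Rabs (flux P Q a c h k)) by now apply Rabs_pos_lt.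
  assert (Heps : 0 < eps).
  { unfold eps. apply Rdiv_lt_0_compat; [|lra]. now apply Rdiv_lt_0_compat. }
  assert (Hl : large eps a c h k).
  { unfold large, eps. replace (_ / _ / _ * _) with (Rabs (flux P Q a c h k) / 2) by (field; lra). lra. }
  pose (ok := fun (n : nat) (p : R * R) =>
    a <= fst p /\ fst p + h / 2 ^ n <= a + h /\ large eps (fst p) (snd p) (h / 2 ^ n) (k / 2 ^ n)).
  assert (H2 : forall n, 0 < 2 ^ n) by (intros; apply pow_lt; lra).
  assert (Hs : forall n, h / 2 ^ S n = h / 2 ^ n / 2 /\ k / 2 ^ S n = k / 2 ^ n / 2).
  { intros n. specialize (H2 n). simpl. split; field; lra. }
  assert (Hq : forall n, 0 < h / 2 ^ n /\ 0 < k / 2 ^ n).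
  { intros n. split; now apply Rdiv_lt_0_compat. }
  assert (step : forall n (p : {p | ok n p}), { q : {q | ok (S n) q} |
    (fst (proj1_sig q) = fst (proj1_sig p) \/ fst (proj1_sig q) = fst (proj1_sig p) + h / 2 ^ n / 2) /\
    (snd (proj1_sig q) = snd (proj1_sig p) \/ snd (proj1_sig q) = snd (proj1_sig p) + k / 2 ^ n / 2) }).
  { intros n [p (O1 & O2 & O3)]. destruct (Hq n) as [q1 q2].
    destruct (large_quarter eps (fst p) (snd p) _ _ q1 ltac:(lra) O3) as [q (Q1 & Q2 & Q3)].
    assert (Oq : ok (S n) q).
    { destruct (Hs n) as [s1 s2]. unfold ok. rewrite s1, s2.
      split; [destruct Q1; lra|]. split; [destruct Q1; lra|assumption]. }
    exists (exist _ q Oq). simpl. auto. }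
  assert (O0 : ok 0%nat (a, c)).
  { unfold ok; simpl. split; [lra|]. split; [lra|].
    replace (h / 1) with h by field. replace (k / 1) with k by field. assumption. }
  pose (seq := fix seq n : {p | ok n p} :=
    match n with O => exist _ (a, c) O0 | S m => proj1_sig (step m (seq m)) end).
  pose (u := fun n => fst (proj1_sig (seq n))). pose (v := fun n => snd (proj1_sig (seq n))).
  assert (Hstep : forall n, (u (S n) = u n \/ u (S n) = u n + h / 2 ^ n / 2) /\
                            (v (S n) = v n \/ v (S n) = v n + k / 2 ^ n / 2)).
  { intros n. exact (proj2_sig (step n (seq n))). }
  assert (Hn : forall n m, u n <= u (n + m)%nat <= u n + h / 2 ^ n /\ v n <= v (n + m)%nat <= v n + k / 2 ^ n /\
     u (n + m)%nat + h / 2 ^ (n + m) <= u n + h / 2 ^ n /\ v (n + m)%nat + k / 2 ^ (n + m) <= v n + k / 2 ^ n).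
  { intros n m. induction m as [|m IH].
    - rewrite Nat.add_0_r. destruct (Hq n). lra.
    - rewrite Nat.add_succ_r. destruct (Hs (n + m)%nat) as [s1 s2]. rewrite s1, s2.
      destruct (Hq (n + m)%nat). destruct (Hstep (n + m)%nat) as [[->| ->] [->| ->]]; lra. }
  (* Corner coordinates increase and stay within the first interval; their limit lies in every
     interval of the nested sequence. *)
  assert (Hlim : forall (w : nat -> R) (s : R), 0 < s ->
      (forall n m, w n <= w (n + m)%nat <= w n + s / 2 ^ n) ->
      exists x, forall n, w n <= x <= w n + s / 2 ^ n).
  { intros w s Hs0 Hw. destruct (ex_finite_lim_seq_incr w (w 0%nat + s / 2 ^ 0)) as [x Hx].
    - intros n. specialize (Hw n 1%nat). rewrite Nat.add_1_r in Hw. lra.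
    - intros n. apply (Hw 0%nat n).
    - exists x. intros n. split.
      + apply (is_lim_seq_incr_compare w x Hx).
        intros m. specialize (Hw m 1%nat). rewrite Nat.add_1_r in Hw. lra.
      + apply (is_lim_seq_le_loc w (fun _ => w n + s / 2 ^ n) x (w n + s / 2 ^ n)); [|assumption|apply is_lim_seq_const].
        exists n. intros m Hm. replace m with (n + (m - n))%nat by lia. apply Hw. }
  destruct (Hlim u h Hh) as [x Hx]; [intros n m; apply (Hn n m)|].
  destruct (Hlim v k Hk) as [y Hy]; [intros n m; apply (Hn n m)|].
  assert (HxX : x < X).
  { specialize (Hx 0%nat). unfold u in Hx; simpl in Hx. lra. }
  (* All rectangles of the bisection are similar, so the ratio of area to the square of [h + k] is
     constant; this factor turns the bound of [flux_small] into a multiple [eps] of the area. *)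
  assert (Heps' : 0 < eps * (h * k) / ((h + k) * (h + k))).
  { apply Rdiv_lt_0_compat; apply Rmult_lt_0_compat; lra. }
  destruct (flux_small x y HxX _ Heps') as (delta & Hd & Hsmall).
  assert (Hsm : exists n, h / 2 ^ n < delta /\ k / 2 ^ n < delta).
  { destruct (pow_lt_1_zero (/ 2) ltac:(rewrite Rabs_pos_eq; lra) (delta / (h + k))) as [n Hnn].
    { apply Rdiv_lt_0_compat; lra. }
    exists n. specialize (Hnn n ltac:(lia)). rewrite Rabs_pos_eq in Hnn by (apply pow_le; lra).
    rewrite pow_inv in Hnn.
    assert (Hi : 0 < / 2 ^ n) by (apply Rinv_0_lt_compat, H2).
    assert (Hz : / 2 ^ n * (h + k) < delta).
    { apply Rmult_lt_reg_r with (/ (h + k)); [apply Rinv_0_lt_compat; lra|].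
      rewrite Rmult_assoc, Rinv_r by lra. lra. }
    unfold Rdiv. nra. }
  destruct Hsm as (n & Hn1 & Hn2). destruct (Hq n) as [q1 q2].
  pose proof (proj2_sig (seq n)) as (O1 & O2 & O3).
  fold (u n) in O1, O2, O3. fold (v n) in O3.
  assert (Hb : Rabs (flux P Q (u n) (v n) (h / 2 ^ n) (k / 2 ^ n)) <= eps * (h / 2 ^ n * (k / 2 ^ n))).
  { eapply Rle_trans; [apply Hsmall; try lra; auto|].
    specialize (H2 n). apply Req_le. field. split; lra. }
  unfold large in O3. lra.
Qed.

(** By periodicity of [Q] the two horizontal sides cancel in the zero flux. In polar coordinates
    this says that circular means do not depend on the radius. *)
Lemma vertical_integral_constant c k : 0 < k ->
  (forall x, x < X -> Q x (c + k) = Q x c) ->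
  forall a b, a < b -> b < X -> RInt (P a) c (c + k) = RInt (P b) c (c + k).
Proof.
  intros Hk Hper a b Hab Hb.
  assert (H := flux_zero a c (b - a) k ltac:(lra) Hk ltac:(lra)).
  rewrite flux_eq in H by lra. replace (a + (b - a)) with b in H by ring.
  rewrite (RInt_ext (fun x => Q x (c + k)) (fun x => Q x c)) in H.
  - lra.
  - intros x Hx. apply Hper. rewrite Rmax_right in Hx by lra. lra.
Qed.

End Green.

(** * Complex differentiability *)

(** Continuity is taken relative to [D] because elements of [disc_algebra] are extended by zero and
    may jump across the unit circle. *)
Definition continuous_within (D : C -> Prop) (f : C -> C) (z : C) : Prop :=
  forall eps, 0 < eps -> exists delta, 0 < delta /\
    forall x, D x -> Cmod (x - z) < delta -> Cmod (f x - f z) < eps.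

(* Caratheodory's form of the complex derivative: [q] is the difference quotient. *)
Definition has_derivative (f : C -> C) (z l : C) : Prop :=
  exists q : C -> C, q z = l /\ continuous_within (fun _ => True) q z /\
    forall x, (f x - f z = q x * (x - z))%C.

Lemma Cmod_minus_sym x y : Cmod (x - y) = Cmod (y - x).
Proof. rewrite <- Cmod_opp. f_equal. ring. Qed.

Lemma Cmod_minus_triangle x y z : Cmod (x - z) <= Cmod (x - y) + Cmod (y - z).
Proof. replace (x - z)%C with ((x - y) + (y - z))%C by ring. apply Cmod_triangle. Qed.

Lemma Cmod_le_minus x y : Cmod x <= Cmod y + Cmod (x - y).
Proof. replace x with (y + (x - y))%C at 1 by ring. apply Cmod_triangle. Qed.

Lemma continuous_within_weaken (D E : C -> Prop) f z :
  (forall x, E x -> D x) -> continuous_within D f z -> continuous_within E f z.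
Proof.
  intros H Hf eps He. destruct (Hf eps He) as (d & Hd & Hx).
  exists d. split; auto.
Qed.

Lemma continuous_within_const D c z : continuous_within D (fun _ => c) z.
Proof.
  intros eps He. exists 1. split; [lra|]. intros x _ _.
  replace (c - c)%C with (RtoC 0) by ring. now rewrite Cmod_0.
Qed.

Lemma continuous_within_id D z : continuous_within D (fun x => x) z.
Proof. intros eps He. exists eps. auto. Qed.

Lemma continuous_within_plus D f g z : continuous_within D f z -> continuous_within D g z ->
  continuous_within D (fun x => f x + g x)%C z.
Proof.
  intros Hf Hg eps He.
  destruct (Hf (eps / 2)) as (d1 & P1 & H1); [lra|].
  destruct (Hg (eps / 2)) as (d2 & P2 & H2); [lra|].
  exists (Rmin d1 d2). split; [now apply Rmin_case|]. intros x Dx Hx.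
  assert (A1 := H1 x Dx (Rlt_le_trans _ _ _ Hx (Rmin_l _ _))).
  assert (A2 := H2 x Dx (Rlt_le_trans _ _ _ Hx (Rmin_r _ _))).
  replace (f x + g x - (f z + g z))%C with ((f x - f z) + (g x - g z))%C by ring.
  eapply Rle_lt_trans; [apply Cmod_triangle|]. lra.
Qed.

Lemma continuous_within_mult D f g z : continuous_within D f z -> continuous_within D g z ->
  continuous_within D (fun x => f x * g x)%C z.
Proof.
  intros Hf Hg eps He.
  set (A := Cmod (f z)). set (B := Cmod (g z)).
  assert (HA : 0 <= A) by apply Cmod_ge_0. assert (HB : 0 <= B) by apply Cmod_ge_0.
  (* With [e <= 1] the product of the two errors is below [e], and the three error terms add up to
     less than [e * (A + B + 1)]. *)
  set (e := Rmin 1 (eps / (A + B + 1))).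
  assert (Hq : 0 < eps / (A + B + 1)) by (apply Rdiv_lt_0_compat; lra).
  assert (Pe : 0 < e) by (apply Rmin_case; lra).
  assert (Ee : e * (A + B + 1) <= eps).
  { replace eps with (eps / (A + B + 1) * (A + B + 1)) by (field; lra).
    apply Rmult_le_compat_r; [lra|apply Rmin_r]. }
  assert (E1 : e <= 1) by apply Rmin_l.
  destruct (Hf e Pe) as (d1 & P1 & H1). destruct (Hg e Pe) as (d2 & P2 & H2).
  exists (Rmin d1 d2). split; [now apply Rmin_case|]. intros x Dx Hx.
  assert (A1 := H1 x Dx (Rlt_le_trans _ _ _ Hx (Rmin_l _ _))).
  assert (A2 := H2 x Dx (Rlt_le_trans _ _ _ Hx (Rmin_r _ _))).
  replace (f x * g x - f z * g z)%C
    with ((f x - f z) * (g x - g z) + (f z * (g x - g z) + (f x - f z) * g z))%C by ring.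
  eapply Rle_lt_trans; [apply Cmod_triangle|].
  eapply Rle_lt_trans; [apply Rplus_le_compat_l, Cmod_triangle|].
  rewrite !Cmod_mult. fold A B.
  assert (G1 := Cmod_ge_0 (f x - f z)). assert (G2 := Cmod_ge_0 (g x - g z)).
  set (u := Cmod (f x - f z)) in *. set (v := Cmod (g x - g z)) in *.
  assert (u * v < e * 1) by (apply Rmult_le_0_lt_compat; lra).
  assert (A * v <= A * e) by (apply Rmult_le_compat_l; lra).
  assert (u * B <= e * B) by (apply Rmult_le_compat_r; lra). lra.
Qed.

Lemma continuous_within_opp D f z : continuous_within D f z ->
  continuous_within D (fun x => - f x)%C z.
Proof.
  intros Hf eps He. destruct (Hf eps He) as (d & Hd & H). exists d; split; [assumption|].
  intros x Dx Hx. replace (- f x - - f z)%C with (- (f x - f z))%C by ring.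
  rewrite Cmod_opp. auto.
Qed.

Lemma continuous_within_minus D f g z : continuous_within D f z -> continuous_within D g z ->
  continuous_within D (fun x => f x - g x)%C z.
Proof. intros Hf Hg. apply continuous_within_plus; [|apply continuous_within_opp]; assumption. Qed.

Lemma continuous_within_inv D f z : continuous_within D f z -> f z <> 0%C ->
  continuous_within D (fun x => / f x)%C z.
Proof.
  intros Hf Hz eps He. set (A := Cmod (f z)).
  assert (HA : 0 < A) by now apply Cmod_gt_0.
  (* The first bound keeps the modulus of [f x] above [A / 2]; the second then absorbs the
     denominator, whose modulus exceeds [A * A / 2]. *)
  destruct (Hf (Rmin (A / 2) (eps * (A * A) / 2))) as (d & Hd & H).
  { apply Rmin_case; [lra|]. apply Rdiv_lt_0_compat; [|lra].
    apply Rmult_lt_0_compat; [lra|]. now apply Rmult_lt_0_compat. }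
  exists d. split; [assumption|]. intros x Dx Hx. specialize (H x Dx Hx).
  assert (M1 := Rmin_l (A / 2) (eps * (A * A) / 2)).
  assert (M2 := Rmin_r (A / 2) (eps * (A * A) / 2)).
  assert (HB : A / 2 < Cmod (f x)).
  { assert (T := Cmod_le_minus (f z) (f x)). rewrite Cmod_minus_sym in T. fold A in T. lra. }
  assert (Hne : f x <> 0%C) by (apply Cmod_gt_0; lra).
  replace (/ f x - / f z)%C with ((f z - f x) / (f x * f z))%C by (field; auto).
  rewrite Cmod_div by (now apply Cmult_neq_0). rewrite Cmod_mult, Cmod_minus_sym. fold A.
  assert (HP : A / 2 * A < Cmod (f x) * A) by (apply Rmult_lt_compat_r; lra).
  assert (HP0 : 0 < A / 2 * A) by (apply Rmult_lt_0_compat; lra).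
  apply Rmult_lt_reg_r with (Cmod (f x) * A); [lra|].
  unfold Rdiv. rewrite Rmult_assoc, Rinv_l by lra. nra.
Qed.

Lemma continuous_within_comp D E f g z : continuous_within D g z ->
  (forall x, D x -> E (g x)) -> continuous_within E f (g z) ->
  continuous_within D (fun x => f (g x)) z.
Proof.
  intros Hg HD Hf eps He. destruct (Hf eps He) as (d & Hd & H).
  destruct (Hg d Hd) as (d' & Hd' & H'). exists d'. split; auto.
Qed.

Lemma has_derivative_continuous D f z l : has_derivative f z l -> continuous_within D f z.
Proof.
  intros (q & _ & Hq & Hf).
  assert (H : continuous_within D (fun x => f z + q x * (x - z))%C z).
  { apply continuous_within_plus; [apply continuous_within_const|].
    apply continuous_within_mult; [now apply (continuous_within_weaken (fun _ => True))|].
    apply continuous_within_minus; [apply continuous_within_id|apply continuous_within_const]. }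
  intros eps He. destruct (H eps He) as (d & Hd & Hx). exists d. split; [assumption|].
  intros x Dx Hxd. specialize (Hx x Dx Hxd). rewrite <- Hf in Hx.
  replace (f z + (f x - f z) - (f z + q z * (z - z)))%C with (f x - f z)%C in Hx by ring.
  assumption.
Qed.

Lemma has_derivative_eq f z k l : has_derivative f z k -> k = l -> has_derivative f z l.
Proof. now intros H <-. Qed.

Lemma has_derivative_const c z : has_derivative (fun _ => c) z 0.
Proof.
  exists (fun _ => 0%C). split; [easy|]. split; [apply continuous_within_const|].
  intros x. ring.
Qed.

Lemma has_derivative_id z : has_derivative (fun x => x) z 1.
Proof.
  exists (fun _ => 1%C). split; [easy|]. split; [apply continuous_within_const|].
  intros x. ring.
Qed.

Lemma has_derivative_plus f g z k l : has_derivative f z k -> has_derivative g z l ->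
  has_derivative (fun x => f x + g x)%C z (k + l).
Proof.
  intros (q & <- & Hq & Hf) (r & <- & Hr & Hg).
  exists (fun x => q x + r x)%C. split; [easy|]. split; [now apply continuous_within_plus|].
  intros x. replace (f x + g x - (f z + g z))%C with ((f x - f z) + (g x - g z))%C by ring.
  rewrite Hf, Hg. ring.
Qed.

Lemma has_derivative_mult f g z k l : has_derivative f z k -> has_derivative g z l ->
  has_derivative (fun x => f x * g x)%C z (k * g z + f z * l).
Proof.
  intros Df (r & <- & Hr & Hg). assert (Cf := has_derivative_continuous (fun _ => True) f z k Df).
  destruct Df as (q & <- & Hq & Hf).
  exists (fun x => q x * g z + f x * r x)%C. split; [easy|]. split.
  - apply continuous_within_plus; apply continuous_within_mult; auto using continuous_within_const.
  - intros x.
    replace (f x * g x - f z * g z)%C with ((f x - f z) * g z + f x * (g x - g z))%C by ring.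
    rewrite Hf, Hg. ring.
Qed.

Lemma has_derivative_opp f z k : has_derivative f z k -> has_derivative (fun x => - f x)%C z (- k).
Proof.
  intros (q & <- & Hq & Hf).
  exists (fun x => - q x)%C. split; [easy|]. split; [now apply continuous_within_opp|].
  intros x. replace (- f x - - f z)%C with (- (f x - f z))%C by ring. rewrite Hf. ring.
Qed.

Lemma has_derivative_minus f g z k l : has_derivative f z k -> has_derivative g z l ->
  has_derivative (fun x => f x - g x)%C z (k - l).
Proof. intros Hf Hg. apply has_derivative_plus; [|apply has_derivative_opp]; assumption. Qed.

Lemma has_derivative_comp f g z k l : has_derivative g z l -> has_derivative f (g z) k ->
  has_derivative (fun x => f (g x)) z (k * l).
Proof.
  intros Dg (q & <- & Hq & Hf). assert (Cg := has_derivative_continuous (fun _ => True) g z l Dg).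
  destruct Dg as (r & <- & Hr & Hg).
  exists (fun x => q (g x) * r x)%C. split; [easy|]. split.
  - apply continuous_within_mult; [|assumption].
    apply (continuous_within_comp _ (fun _ => True)); auto.
  - intros x. rewrite Hf, Hg. ring.
Qed.

(* When [f x = 0] the difference quotient of [/ f] has no good formula, so it is
   redefined there; this does not affect continuity at [z]. *)
Lemma has_derivative_inv f z k : has_derivative f z k -> f z <> 0%C ->
  has_derivative (fun x => / f x)%C z (- k / (f z * f z)).
Proof.
  intros Df Hz. assert (Cf := has_derivative_continuous (fun _ => True) f z k Df).
  destruct Df as (q & <- & Hq & Hf).
  exists (fun x => if Ceq_dec (f x) 0 then - / (f z * (x - z)) else - q x / (f x * f z))%C.
  split; [|split].
  - destruct (Ceq_dec (f z) 0); [contradiction|easy].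
  - assert (H : continuous_within (fun _ => True) (fun x => - q x * / (f x * f z))%C z).
    { apply continuous_within_mult; [now apply continuous_within_opp|].
      apply continuous_within_inv; [|now apply Cmult_neq_0].
      apply continuous_within_mult; [assumption|apply continuous_within_const]. }
    intros eps He. destruct (H eps He) as (d & Hd & Hx).
    destruct (Cf (Cmod (f z))) as (d' & Hd' & Hx'); [now apply Cmod_gt_0|].
    exists (Rmin d d'). split; [now apply Rmin_case|]. intros x _ Hxd.
    specialize (Hx x I (Rlt_le_trans _ _ _ Hxd (Rmin_l _ _))).
    specialize (Hx' x I (Rlt_le_trans _ _ _ Hxd (Rmin_r _ _))).
    destruct (Ceq_dec (f z) 0); [contradiction|].
    destruct (Ceq_dec (f x) 0) as [E|E]; [|exact Hx].
    exfalso. rewrite E in Hx'. replace (0 - f z)%C with (- f z)%C in Hx' by ring.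
    rewrite Cmod_opp in Hx'. lra.
  - intros x. destruct (Ceq_dec (f x) 0) as [E|E].
    + assert (Hne : (x - z)%C <> 0%C).
      { intros E2. specialize (Hf x). rewrite E2, E in Hf. apply Hz.
        replace (f z) with (- (0 - f z))%C by ring. rewrite Hf. ring. }
      (* The inverse of 0 is 0 by convention, both components having numerator 0; the redefined
         quotient is chosen to match this value. *)
      assert (E0 : (/ f x = 0)%C).
      { rewrite E. unfold Cinv; simpl. unfold Rdiv. apply injective_projections; simpl; ring. }
      rewrite E0. field. auto.
    + replace (- q x / (f x * f z) * (x - z))%C with (- (q x * (x - z)) / (f x * f z))%C
        by (field; auto).
      rewrite <- Hf. field. auto.
Qed.

(** * Passage between moduli and the filters and derivatives of the library *)

Lemma ball_Cmod (z : C) r x : Cmod (x - z) < r -> ball (M := C_UniformSpace) z r x.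
Proof. exact (C_NormedModule_mixin_compat1 z x r). Qed.

(** Balls of [C_UniformSpace] are squares, so the modulus may exceed the radius by a factor up to
    the square root of 2, here rounded up to 2. *)
Lemma Cmod_ball (z : C) r x : 0 < r -> ball (M := C_UniformSpace) z r x -> Cmod (x - z) < 2 * r.
Proof.
  intros Hr H. apply (C_NormedModule_mixin_compat2 z x (mkposreal r Hr)) in H. simpl in H.
  assert (sqrt 2 < 2).
  { rewrite <- (sqrt_Rsqr 2) at 2 by lra. apply sqrt_lt_1; unfold Rsqr; lra. }
  eapply Rlt_trans; [exact H|]. now apply Rmult_lt_compat_r.
Qed.

Lemma locally_Cmod (z : C) (P : C -> Prop) :
  locally (T := C_UniformSpace) z P <->
  exists delta, 0 < delta /\ forall x, Cmod (x - z) < delta -> P x.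
Proof.
  split.
  - intros [d Hd]. exists d. split; [apply cond_pos|]. intros x Hx. now apply Hd, ball_Cmod.
  - intros (d & Hd & H). exists (mkposreal (d / 2) ltac:(lra)). intros x Hx.
    apply H. apply Cmod_ball in Hx; simpl in *; lra.
Qed.

Lemma continuous_within_filterlim D f z :
  continuous_within D f z <->
  filterlim (T := C) (U := C_UniformSpace) f (within D (locally (T := C_UniformSpace) z))
    (locally (T := C_UniformSpace) (f z)).
Proof.
  split.
  - intros H P HP. apply locally_Cmod in HP. destruct HP as (e & He & HP).
    destruct (H e He) as (d & Hd & Hx).
    apply locally_Cmod. exists d. auto.
  - intros H eps He.
    assert (L : locally (T := C_UniformSpace) (f z) (fun y => Cmod (y - f z) < eps)).
    { apply locally_Cmod. exists eps. auto. }
    specialize (H _ L). apply locally_Cmod in H. destruct H as (d & Hd & H).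
    exists d. auto.
Qed.

Lemma da_continuous_within (f : disc_algebra) z :
  closed_disc z -> continuous_within closed_disc f z.
Proof. intros Hz. apply continuous_within_filterlim, da_continuous, Hz. Qed.

Lemma has_derivative_of_is_derive f z l :
  is_derive (K := C_AbsRing) (V := C_NormedModule) f z l -> has_derivative f z l.
Proof.
  intros [_ H]. specialize (H z (fun P HP => HP)).
  exists (fun x => if Ceq_dec x z then l else (f x - f z) / (x - z))%C. split; [|split].
  - now destruct (Ceq_dec z z).
  - intros eps He. destruct (H (mkposreal (eps / 2) ltac:(lra))) as [d Hd].
    exists d. split; [apply cond_pos|]. intros x _ Hx.
    destruct (Ceq_dec z z) as [_|n]; [|now destruct n].
    destruct (Ceq_dec x z) as [E|E].
    { replace (l - l)%C with (RtoC 0) by ring. now rewrite Cmod_0. }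
    specialize (Hd x Hx). simpl in Hd.
    change (Cmod ((f x - f z) - (x - z) * l)%C <= eps / 2 * Cmod (x - z)%C) in Hd.
    assert (Hne : (x - z)%C <> 0%C).
    { intros E2. apply E. replace x with ((x - z) + z)%C by ring. rewrite E2. ring. }
    replace ((f x - f z) / (x - z) - l)%C with (((f x - f z) - (x - z) * l) / (x - z))%C
      by (field; auto).
    rewrite Cmod_div by assumption.
    assert (0 < Cmod (x - z)) by now apply Cmod_gt_0.
    apply Rmult_lt_reg_r with (Cmod (x - z)); [assumption|].
    unfold Rdiv. rewrite Rmult_assoc, Rinv_l by lra. nra.
  - intros x. destruct (Ceq_dec x z) as [->|E]; [ring|]. field.
    intros E2. apply E. replace x with ((x - z) + z)%C by ring. rewrite E2. ring.
Qed.

Lemma is_derive_of_has_derivative f z l :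
  has_derivative f z l -> is_derive (K := C_AbsRing) (V := C_NormedModule) f z l.
Proof.
  intros (q & <- & Hq & Hf). split.
  - exact (is_linear_scal_l (K := C_AbsRing) (V := C_NormedModule) (q z)).
  - intros y Hy.
    apply (is_filter_lim_locally_unique (K := C_AbsRing) (V := AbsRing_NormedModule C_AbsRing)) in Hy.
    subst y. intros eps. destruct (Hq eps (cond_pos eps)) as (d & Hd & H).
    exists (mkposreal d Hd). intros x Hx. specialize (H x I Hx).
    change (Cmod ((f x - f z) - (x - z) * q z)%C <= eps * Cmod (x - z)%C).
    rewrite Hf. replace (q x * (x - z) - (x - z) * q z)%C with ((q x - q z) * (x - z))%C by ring.
    rewrite Cmod_mult. apply Rmult_le_compat_r; [apply Cmod_ge_0|lra].
Qed.

Lemma da_has_derivative (f : disc_algebra) z :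
  open_disc z -> exists l, has_derivative f z l.
Proof.
  intros Hz. destruct (da_holomorphic f z Hz) as [l Hl]. exists l.
  now apply has_derivative_of_is_derive.
Qed.

(** The Cauchy-Riemann equations. The remainder after multiplication by [l] is [q (u, v) - q (x, y)]
    times the increment, and its modulus dominates both of its components. *)
Lemma has_derivative_differentiable f x y l :
  has_derivative f (x, y) l ->
  differentiable_pt_lim (fun u v => Re (f (u, v))) x y (Re l) (- Im l) /\
  differentiable_pt_lim (fun u v => Im (f (u, v))) x y (Im l) (Re l).
Proof.
  intros (q & <- & Hq & Hf).
  assert (H : forall eps : posreal, exists delta : posreal, forall u v : R,
    Rabs (u - x) < delta -> Rabs (v - y) < delta ->
    Cmod ((q (u, v) - q (x, y)) * ((u, v) - (x, y)))%C <= eps * Rmax (Rabs (u - x)) (Rabs (v - y))).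
  (* Half of [eps] compensates the factor 2 between the modulus of the increment and its larger
     coordinate. *)
  { intros eps. destruct (Hq (eps / 2)) as (d & Hd & H); [apply is_pos_div_2|].
    exists (mkposreal (d / 2) ltac:(lra)). simpl. intros u v Hu Hv.
    assert (B : Cmod ((u, v) - (x, y))%C <= 2 * Rmax (Rabs (u - x)) (Rabs (v - y))).
    { eapply Rle_trans; [apply Cmod_2Rmax|]. simpl.
      apply Rmult_le_compat_r.
      - eapply Rle_trans; [apply Rabs_pos|apply Rmax_l].
      - rewrite <- (sqrt_Rsqr 2) at 2 by lra. apply sqrt_le_1; unfold Rsqr; lra. }
    assert (B' : Rmax (Rabs (u - x)) (Rabs (v - y)) < d / 2) by now apply Rmax_case.
    rewrite Cmod_mult.
    assert (B2 := H (u, v) I ltac:(lra)).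
    assert (G := Cmod_ge_0 (q (u, v) - q (x, y))). assert (G' := Cmod_ge_0 ((u, v) - (x, y))).
    apply Rle_trans with (eps / 2 * (2 * Rmax (Rabs (u - x)) (Rabs (v - y)))); [|lra].
    apply Rmult_le_compat; lra. }
  split; intros eps; destruct (H eps) as [d Hd]; exists d; intros u v Hu Hv;
    (eapply Rle_trans; [|exact (Hd u v Hu Hv)]);
    (eapply Rle_trans; [|apply Rmax_Cmod]); assert (E := Hf (u, v)).
  - eapply Rle_trans; [|apply Rmax_l]. apply Req_le. f_equal.
    apply (f_equal Re) in E. unfold Re, Im in *. simpl in *. lra.
  - eapply Rle_trans; [|apply Rmax_r]. apply Req_le. f_equal.
    apply (f_equal Im) in E. unfold Re, Im in *. simpl in *. lra.
Qed.

(** * The value at the centre of a disc *)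

(** The exponential of [s + i t]; the half-plane [s < 0] is mapped onto the punctured unit disc. *)
Definition polar (s t : R) : C := (exp s * cos t, exp s * sin t).

Lemma Cmod_polar s t : Cmod (polar s t) = exp s.
Proof.
  unfold Cmod, polar. simpl.
  replace (_ + _) with (exp s * exp s * (Rsqr (sin t) + Rsqr (cos t))) by (unfold Rsqr; ring).
  rewrite sin2_cos2, Rmult_1_r. apply sqrt_square. left; apply exp_pos.
Qed.

Lemma differentiable_mult x y : differentiable_pt_lim Rmult x y y x.
Proof.
  intros eps. exists eps. intros u v Hu _.
  replace (u * v - x * y - (y * (u - x) + x * (v - y))) with ((u - x) * (v - y)) by ring.
  rewrite Rabs_mult. apply Rmult_le_compat; [apply Rabs_pos|apply Rabs_pos|lra|apply Rmax_r].
Qed.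

Lemma differentiable_snd g x y l :
  derivable_pt_lim g y l -> differentiable_pt_lim (fun _ v => g v) x y 0 l.
Proof.
  intros Hg. replace 0 with (l * 0 + 0 * 1) by ring. replace l with (l * 1 + 0 * 0) at 2 by ring.
  apply (differentiable_pt_lim_comp (fun a _ => g a) (fun _ v => v) (fun u _ => u)).
  - now apply differentiable_pt_lim_proj1_0.
  - intros eps. exists eps. intros u v _ _.
    replace (v - y - (0 * (u - x) + 1 * (v - y))) with 0 by ring. rewrite Rabs_R0.
    apply Rmult_le_pos; [left; apply cond_pos|].
    eapply Rle_trans; [apply Rabs_pos|apply Rmax_l].
  - intros eps. exists eps. intros u v _ _.
    replace (u - x - (1 * (u - x) + 0 * (v - y))) with 0 by ring. rewrite Rabs_R0.
    apply Rmult_le_pos; [left; apply cond_pos|].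
    eapply Rle_trans; [apply Rabs_pos|apply Rmax_l].
Qed.

Lemma differentiable_separated f g x y k l :
  derivable_pt_lim f x k -> derivable_pt_lim g y l ->
  differentiable_pt_lim (fun u v => f u * g v) x y (k * g y) (f x * l).
Proof.
  intros Hf Hg.
  replace (k * g y) with (g y * k + f x * 0) by ring.
  replace (f x * l) with (g y * 0 + f x * l) by ring.
  apply (differentiable_pt_lim_comp Rmult (fun u _ => f u) (fun _ v => g v)).
  - apply differentiable_mult.
  - now apply differentiable_pt_lim_proj1_0.
  - now apply differentiable_snd.
Qed.

Lemma polar_cauchy_riemann G s t l : has_derivative G (polar s t) l -> exists p q r,
  differentiable_pt_lim (fun s t => Re (G (polar s t))) s t p q /\
  differentiable_pt_lim (fun s t => - Im (G (polar s t))) s t r (- p).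
Proof.
  intros H. apply has_derivative_differentiable in H. destruct H as [HR HI].
  assert (Hx := differentiable_separated exp cos s t _ _ (derivable_pt_lim_exp s) (derivable_pt_lim_cos t)).
  assert (Hy := differentiable_separated exp sin s t _ _ (derivable_pt_lim_exp s) (derivable_pt_lim_sin t)).
  assert (HN : differentiable_pt_lim (fun u v => - Im (G (u, v))) (exp s * cos t) (exp s * sin t) (- Im l) (- Re l)).
  { intros eps. destruct (HI eps) as [d Hd]. exists d. intros u v Hu Hv.
    rewrite <- Rabs_Ropp.
    replace (- (_ - _ - _)) with (Im (G (u, v)) - Im (G (exp s * cos t, exp s * sin t)) -
      (Im l * (u - exp s * cos t) + Re l * (v - exp s * sin t))) by ring.
    exact (Hd u v Hu Hv). }
  (* With [w = polar s t], the complex derivative of [G] in the variable [s + i t] is [l * w]; the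
     witnesses are its real part and twice the opposite of its imaginary part, listed separately. *)
  exists (Re l * (exp s * cos t) + - Im l * (exp s * sin t)),
         (Re l * (exp s * - sin t) + - Im l * (exp s * cos t)),
         (- Im l * (exp s * cos t) + - Re l * (exp s * sin t)).
  split.
  - exact (differentiable_pt_lim_comp (fun u v => Re (G (u, v))) (fun s t => exp s * cos t)
      (fun s t => exp s * sin t) s t _ _ _ _ _ _ HR Hx Hy).
  - replace (- (_ + _)) with (- Im l * (exp s * - sin t) + - Re l * (exp s * cos t)) by ring.
    exact (differentiable_pt_lim_comp (fun u v => - Im (G (u, v))) (fun s t => exp s * cos t)
      (fun s t => exp s * sin t) s t _ _ _ _ _ _ HN Hx Hy).
Qed.

(** The mean of [Re G] over a circle does not depend on its radius in the punctured disc. If [Re L]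
    exceeded [M], the mean over a small circle would exceed [M], whereas over the circle of radius
    [r] it is at most [M]. *)
Lemma Re_center_le G L r M :
  (forall z, 0 < Cmod z < 1 -> exists l, has_derivative G z l) ->
  (forall eps, 0 < eps -> exists delta, 0 < delta /\
     forall z, 0 < Cmod z < delta -> Cmod (G z - L) < eps) ->
  0 < r < 1 -> (forall z, Cmod z = r -> Re (G z) <= M) -> Re L <= M.
Proof.
  intros HG HL Hr HM. apply Rnot_lt_le. intros Hlt.
  set (P := fun s t => Re (G (polar s t))). set (Q := fun s t => - Im (G (polar s t))).
  assert (HPQ : forall s t, s < 0 -> exists p q r,
    differentiable_pt_lim P s t p q /\ differentiable_pt_lim Q s t r (- p)).
  { intros s t Hs. destruct (HG (polar s t)) as [l Hl].
    - rewrite Cmod_polar. split; [apply exp_pos|]. rewrite <- exp_0. now apply exp_increasing.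
    - exact (polar_cauchy_riemann G s t l Hl). }
  destruct (HL ((Re L - M) / 2)) as (d & Hd & Hnear); [lra|].
  assert (H2PI : 0 < 2 * PI) by (assert (H := PI_RGT_0); lra).
  (* The circle [s = b] is the given one; [s = a] is a smaller one inside the neighbourhood of 0
     where [G] is close to [L]. *)
  set (b := ln r). set (a := Rmin (ln r - 1) (ln d - 1)).
  assert (Hb : b < 0) by (unfold b; rewrite <- ln_1; apply ln_increasing; lra).
  assert (Hab : a < b).
  { apply Rle_lt_trans with (1 := Rmin_l _ _). unfold b; lra. }
  assert (Had : exp a < d).
  { rewrite <- (exp_ln d) by assumption. apply exp_increasing.
    apply Rle_lt_trans with (1 := Rmin_r _ _). lra. }
  assert (E := vertical_integral_constant P Q 0 HPQ 0 (2 * PI) H2PI).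
  assert (E' : RInt (P a) 0 (0 + 2 * PI) = RInt (P b) 0 (0 + 2 * PI)).
  { apply E; [|assumption|assumption]. intros s _. unfold Q, polar.
    rewrite Rplus_0_l, cos_2PI, sin_2PI, cos_0, sin_0. reflexivity. }
  assert (Ub : RInt (P b) 0 (0 + 2 * PI) <= RInt (fun _ => M) 0 (0 + 2 * PI)).
  { apply RInt_le; [lra|now apply (ex_RInt_vertical P Q 0 HPQ)|apply ex_RInt_const|].
    intros t _. apply HM. rewrite Cmod_polar. unfold b. apply exp_ln. lra. }
  assert (La : RInt (fun _ => Re L - (Re L - M) / 2) 0 (0 + 2 * PI) <= RInt (P a) 0 (0 + 2 * PI)).
  { apply RInt_le; [lra|apply ex_RInt_const|apply (ex_RInt_vertical P Q 0 HPQ); lra|].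
    intros t _. unfold P. specialize (Hnear (polar a t)). rewrite Cmod_polar in Hnear.
    specialize (Hnear (conj (exp_pos a) Had)).
    assert (H := re_le_Cmod (G (polar a t) - L)).
    assert (H' : Rabs (Re (G (polar a t) - L)) <= (Re L - M) / 2) by lra.
    apply Rabs_le_between in H'. change (Re (G (polar a t) - L)) with (Re (G (polar a t)) - Re L) in H'.
    lra. }
  rewrite RInt_const in Ub, La. change scal with Rmult in Ub, La. simpl in Ub, La. nra.
Qed.

(** The function [G] below has limit [Cconj l * l * rad] at 0, a real number: the factor [Cconj l]
    reduces a bound on the modulus to one on a real part. The 4 comes from a difference of two
    values bounded by [B], divided by [z] on the circle of radius 1/2. *)
Lemma Cauchy_derivative_estimate f p rad B l : 0 < rad ->
  (forall x, Cmod (x - p) < rad -> exists k, has_derivative f x k) ->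
  (forall x, Cmod (x - p) < rad -> Cmod (f x) <= B) ->
  has_derivative f p l -> Cmod l <= 4 * B / rad.
Proof.
  intros HR Hf HB Hl.
  set (G := fun z => (Cconj l * ((f (p + rad * z) - f p) * / z))%C).
  assert (HRC : Cmod rad = rad) by (rewrite Cmod_R; apply Rabs_pos_eq; lra).
  assert (Hin : forall z, Cmod z < 1 -> Cmod (p + rad * z - p) < rad).
  { intros z Hz. replace (p + rad * z - p)%C with (rad * z)%C by ring.
    rewrite Cmod_mult, HRC. nra. }
  assert (Hne : forall z, 0 < Cmod z -> z <> 0%C) by (intros; now apply Cmod_gt_0).
  assert (Haff : forall z, has_derivative (fun z => p + rad * z)%C z rad).
  { intros z. apply (has_derivative_eq _ _ (0 + (0 * z + rad * 1))%C); [|ring].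
    apply has_derivative_plus; [apply has_derivative_const|].
    apply has_derivative_mult; [apply has_derivative_const|apply has_derivative_id]. }
  assert (H : Re (Cconj l * (l * rad))%C <= Cmod l * (4 * B)).
  { apply (Re_center_le G _ (1 / 2)).
    - intros z Hz. destruct (Hf (p + rad * z)%C) as [k Hk]; [apply Hin; lra|].
      eexists. apply has_derivative_mult; [apply has_derivative_const|].
      apply has_derivative_mult.
      + apply has_derivative_minus; [|apply has_derivative_const].
        apply (has_derivative_comp f (fun z => p + rad * z)%C z k); [apply Haff|exact Hk].
      + apply has_derivative_inv; [apply has_derivative_id|apply Hne; lra].
    - destruct Hl as (q & Eq & Cq & Hq).
      assert (HC : continuous_within (fun _ => True) (fun z => Cconj l * (q (p + rad * z) * rad))%C 0).
      { apply continuous_within_mult; [apply continuous_within_const|].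
        apply continuous_within_mult; [|apply continuous_within_const].
        apply (continuous_within_comp _ (fun _ => True) q); auto.
        - exact (has_derivative_continuous _ _ _ _ (Haff 0%C)).
        - now replace (p + rad * 0)%C with p by ring. }
      intros eps He. destruct (HC eps He) as (d & Hd & Hx). exists d. split; [assumption|].
      intros z Hz. specialize (Hx z I).
      replace (z - 0)%C with z in Hx by ring. specialize (Hx (proj2 Hz)).
      replace (p + rad * 0)%C with p in Hx by ring. rewrite Eq in Hx.
      unfold G. rewrite Hq.
      replace (q (p + rad * z) * (p + rad * z - p) * / z)%C with (q (p + rad * z) * rad)%C; [exact Hx|].
      field. apply Hne; lra.
    - lra.
    - intros z Hz. eapply Rle_trans; [apply Rle_abs|]. eapply Rle_trans; [apply re_le_Cmod|].
      unfold G. rewrite !Cmod_mult, Cmod_conj. apply Rmult_le_compat_l; [apply Cmod_ge_0|].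
      rewrite Cmod_inv, Hz by (apply Hne; lra).
      assert (T : Cmod (f (p + rad * z) - f p)%C <= B + B).
      { eapply Rle_trans; [apply Cmod_triangle|]. rewrite Cmod_opp.
        apply Rplus_le_compat; apply HB; [apply Hin; lra|].
        replace (p - p)%C with (RtoC 0) by ring. now rewrite Cmod_0. }
      lra. }
  assert (E : Re (Cconj l * (l * rad))%C = Cmod l ^ 2 * rad).
  { rewrite Cmod2_alt. unfold Re, Im. simpl. ring. }
  rewrite E in H. assert (Hl0 := Cmod_ge_0 l).
  assert (HB0 : 0 <= B).
  { apply Rle_trans with (Cmod (f p)); [apply Cmod_ge_0|]. apply HB.
    replace (p - p)%C with (RtoC 0) by ring. now rewrite Cmod_0. }
  apply Rmult_le_reg_r with rad; [assumption|].
  unfold Rdiv. rewrite (Rmult_assoc _ (/ rad)), Rinv_l, Rmult_1_r by lra.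
  destruct (Req_dec (Cmod l) 0) as [E0|E0]; [rewrite E0; lra|].
  apply Rmult_le_reg_l with (Cmod l); [lra|]. lra.
Qed.

Lemma iter_has_derivative phi p l n : phi p = p -> has_derivative phi p l ->
  has_derivative (Nat.iter n phi) p (l ^ n)%C.
Proof.
  intros Hp Hl. assert (Hfix : forall m, Nat.iter m phi p = p).
  { induction m as [|m IH]; simpl; [easy|]. now rewrite IH. }
  induction n as [|n IH].
  - exact (has_derivative_id p).
  - simpl. apply (has_derivative_comp phi (Nat.iter n phi)); [exact IH|].
    now rewrite Hfix.
Qed.

(** The n-th iterate has derivative [l ^ n] at [p]. Once it maps the disc within [rad / 8] of [p],
    Cauchy's estimate bounds that power by 1/2. *)
Lemma attracting_multiplier phi p rad l : 0 < rad -> phi p = p -> has_derivative phi p l ->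
  (forall n x, Cmod (x - p) < rad -> exists k, has_derivative (Nat.iter n phi) x k) ->
  (forall eps, 0 < eps -> exists n, forall x, Cmod (x - p) < rad -> Cmod (Nat.iter n phi x - p) < eps) ->
  Cmod l < 1.
Proof.
  intros HR Hp Hl Hd Hu.
  destruct (Hu (rad / 8)) as [n Hn]; [lra|].
  apply Rnot_le_lt. intros Hge.
  assert (H : Cmod (l ^ n - 0)%C <= 4 * (rad / 8) / rad).
  { apply (Cauchy_derivative_estimate (fun x => Nat.iter n phi x - p)%C p).
    - assumption.
    - intros x Hx. destruct (Hd n x Hx) as [k Hk]. eexists.
      apply has_derivative_minus; [exact Hk|apply has_derivative_const].
    - intros x Hx. left. now apply Hn.
    - apply has_derivative_minus; [|apply has_derivative_const]. now apply iter_has_derivative. }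
  replace (l ^ n - 0)%C with (l ^ n)%C in H by ring. rewrite Cmod_pow in H.
  assert (1 <= Cmod l ^ n) by now apply pow_R1_Rle.
  replace (4 * (rad / 8) / rad) with (1 / 2) in H by (field; lra). lra.
Qed.

(** * Compactness and dynamics *)

(** Compactness as an induction principle: a family of sets closed under subsets and finite unions
    that contains a neighbourhood of each point contains the disc. It serves both for uniform
    thresholds and for finite subcovers. *)
Lemma disc_compact_induction (r : R) (good : (C -> Prop) -> Prop) :
  good (fun _ => False) ->
  (forall E F : C -> Prop, (forall x, E x -> F x) -> good F -> good E) ->
  (forall E F, good E -> good F -> good (fun x => E x \/ F x)) ->
  (forall t, Cmod t <= r -> exists delta, 0 < delta /\
     good (fun x => Cmod (x - t) < delta /\ Cmod x <= r)) ->
  good (fun x => Cmod x <= r).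
Proof.
  intros good_empty good_sub good_union good_loc.
  (* The covering theorem concerns a square, so centres outside the disc need a radius as well;
     there the radius is chosen to make the set empty. The factor 2 is that of [Cmod_ball]. *)
  assert (Hloc : forall t : C, exists d : posreal,
    good (fun x => Cmod (x - t) < 2 * d /\ Cmod x <= r)).
  { intros t. destruct (Rle_lt_dec (Cmod t) r) as [Ht|Ht].
    - destruct (good_loc t Ht) as (d & Hd & H). exists (mkposreal (d / 2) ltac:(lra)). simpl.
      revert H. apply good_sub. intros x. replace (2 * (d / 2)) with d by field. easy.
    - exists (mkposreal ((Cmod t - r) / 2) ltac:(lra)). simpl.
      revert good_empty. apply good_sub. intros x [Hx Hr].
      assert (T := Cmod_le_minus t x). rewrite Cmod_minus_sym in T. lra. }
  pose (pt := fun t : Compactness.Tn 2 R => (fst t, fst (snd t)) : C).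
  pose (d := fun t => proj1_sig (constructive_indefinite_description _ (Hloc t))).
  assert (Hd : forall t, good (fun x => Cmod (x - t) < 2 * d t /\ Cmod x <= r)).
  { intros t. exact (proj2_sig (constructive_indefinite_description _ (Hloc t))). }
  (* [compactness_list] yields its finite list only under a double negation. *)
  apply NNPP; intros Hno.
  apply (compactness_list 2 (- r, (- r, tt)) (r, (r, tt)) (fun t => d (pt t))).
  intros [l Hl]. apply Hno.
  apply good_sub with (F := fun x => exists t, In t l /\ Cmod (x - pt t) < 2 * d (pt t) /\ Cmod x <= r).
  - intros x Hx. pose proof (Rmax_Cmod x) as Hm.
    pose proof (Rmax_l (Rabs (fst x)) (Rabs (snd x))).
    pose proof (Rmax_r (Rabs (fst x)) (Rabs (snd x))).
    assert (H1 : - r <= fst x <= r) by (apply Rabs_le_between; lra).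
    assert (H2 : - r <= snd x <= r) by (apply Rabs_le_between; lra).
    destruct (Hl (fst x, (snd x, tt))) as [t [Ht [_ Hc]]]; [simpl; tauto|].
    exists t. split; [assumption|]. split; [|assumption].
    apply Cmod_ball; [apply cond_pos|]. destruct t as [t1 [t2 []]]. simpl in Hc.
    split; apply Hc.
  - clear Hl. induction l as [|t l IH].
    + revert good_empty. apply good_sub. intros x [t [[] _]].
    + refine (good_sub _ _ _ (good_union _ _ (Hd (pt t)) IH)).
      intros x [s [[<-|Hs] Hx]]; [now left|]. right. now exists s.
Qed.

Lemma disc_eventually_uniform (r : R) (P : nat -> C -> Prop) :
  (forall n m x, (n <= m)%nat -> P n x -> P m x) ->
  (forall t, Cmod t <= r -> exists n delta, 0 < delta /\
     forall x, Cmod (x - t) < delta -> Cmod x <= r -> P n x) ->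
  exists n, forall x, Cmod x <= r -> P n x.
Proof.
  intros Hmono Hloc.
  apply (disc_compact_induction r (fun E => exists n, forall x, E x -> P n x)).
  - now exists O.
  - intros E F H [n Hn]. exists n. auto.
  - intros E F [n Hn] [m Hm]. exists (Nat.max n m). intros x [Hx|Hx].
    + apply Hmono with n; [lia|auto].
    + apply Hmono with m; [lia|auto].
  - intros t Ht. destruct (Hloc t Ht) as (n & d & Hd & H). exists d. split; [assumption|].
    exists n. intros x []. auto.
Qed.

(** Makes the locally uniform convergence in [Denjoy_Wolff_point] available on closed discs of
    radius below 1. *)
Lemma compact_closed_ball (r : R) :
  compact_set (T := C_UniformSpace) (fun z => Cmod z <= r).
Proof.
  intros F HF Hcov.
  apply (disc_compact_induction r (fun E : C -> Prop => exists l : list (C -> Prop),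
    (forall U, In U l -> F U) /\ (forall x, E x -> exists U, In U l /\ U x))).
  - exists nil. split; [intros U []|easy].
  - intros E G H (l & H1 & H2). exists l. auto.
  - intros E G (l & H1 & H2) (l' & H1' & H2'). exists (l ++ l'). split.
    + intros U HU. apply in_app_or in HU. destruct HU; auto.
    + intros x [Hx|Hx].
      * destruct (H2 x Hx) as (U & HU & HUx). exists U. split; [|assumption].
        apply in_or_app. auto.
      * destruct (H2' x Hx) as (U & HU & HUx). exists U. split; [|assumption].
        apply in_or_app. auto.
  - intros t Ht. destruct (Hcov t Ht) as (U & HU & HUt).
    specialize (HF U HU t HUt). apply locally_Cmod in HF. destruct HF as (d & Hd & H).
    exists d. split; [assumption|]. exists (U :: nil). split.
    + intros V [<-|[]]. assumption.
    + intros x [Hx _]. exists U. split; [now left|auto].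
Qed.

(** * Iterates of the symbol and their convergence to the Denjoy-Wolff point *)

Section Dynamics.
Variable phi : disc_algebra.
Hypothesis phi_closed : forall z, closed_disc z -> closed_disc (phi z).
Hypothesis phi_open : forall z, open_disc z -> open_disc (phi z).

Lemma iter_closed n z : closed_disc z -> closed_disc (Nat.iter n phi z).
Proof. intros Hz. induction n as [|n IH]; simpl; auto. Qed.

Lemma iter_open n z : open_disc z -> open_disc (Nat.iter n phi z).
Proof. intros Hz. induction n as [|n IH]; simpl; auto. Qed.

Lemma iter_continuous n z : closed_disc z ->
  continuous_within closed_disc (Nat.iter n phi) z.
Proof.
  intros Hz. induction n as [|n IH].
  - exact (continuous_within_id _ z).
  - simpl. apply (continuous_within_comp closed_disc closed_disc phi (Nat.iter n phi)).
    + exact IH.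
    + intros x. apply iter_closed.
    + apply da_continuous_within. now apply iter_closed.
Qed.

Lemma iter_ex_derivative n z : open_disc z -> exists l, has_derivative (Nat.iter n phi) z l.
Proof.
  intros Hz. induction n as [|n [l Hl]].
  - exists 1%C. exact (has_derivative_id z).
  - destruct (da_has_derivative phi (Nat.iter n phi z)) as [k Hk]; [now apply iter_open|].
    exists (k * l)%C. exact (has_derivative_comp phi (Nat.iter n phi) z k l Hl Hk).
Qed.

Variable z0 : C.
Hypothesis z0_DW : Denjoy_Wolff_point phi z0.
Hypothesis z0_in : open_disc z0.

Lemma DW_uniform r eps : r < 1 -> 0 < eps ->
  exists N, forall n z, (N <= n)%nat -> Cmod z <= r -> Cmod (Nat.iter n phi z - z0) < eps.
Proof.
  intros Hr He. destruct z0_DW as (_ & _ & _ & _ & H).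
  destruct (H (fun z => Cmod z <= r) (compact_closed_ball r)) with (eps := mkposreal eps He) as [N HN].
  - intros z Hz. unfold open_disc. lra.
  - exists N. intros n z Hn Hz. exact (HN n Hn z Hz).
Qed.

Lemma DW_lim z eps : open_disc z -> 0 < eps ->
  exists N, forall n, (N <= n)%nat -> Cmod (Nat.iter n phi z - z0) < eps.
Proof.
  intros Hz He. destruct (DW_uniform (Cmod z) eps Hz He) as [N HN].
  exists N. intros n Hn. apply HN; [assumption|lra].
Qed.

(** The orbit of [z0] tends to [z0], and so does its shift by one step, which is its image under
    [phi]; continuity at [z0] concludes. *)
Lemma DW_fixed : phi z0 = z0.
Proof.
  assert (Hc : closed_disc z0) by now apply open_disc_closed.
  assert (E : Cmod (phi z0 - z0)%C = 0).
  { apply Rle_antisym; [|apply Cmod_ge_0]. apply le_epsilon. intros eps He.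
    destruct (da_continuous_within phi z0 Hc (eps / 2)) as (d & Hd & H); [lra|].
    destruct (DW_lim z0 (Rmin d (eps / 2)) z0_in) as [N HN]; [apply Rmin_case; lra|].
    assert (H1 := HN N ltac:(lia)). assert (H2 := HN (S N) ltac:(lia)).
    specialize (H (Nat.iter N phi z0) (iter_closed N z0 Hc) (Rlt_le_trans _ _ _ H1 (Rmin_l _ _))).
    assert (H3 := Rlt_le_trans _ _ _ H2 (Rmin_r _ _)). simpl in H3.
    assert (T := Cmod_minus_triangle (phi z0) (phi (Nat.iter N phi z0)) z0).
    rewrite (Cmod_minus_sym (phi z0) (phi (Nat.iter N phi z0))) in T. lra. }
  apply Cmod_eq_0 in E. replace (phi z0) with ((phi z0 - z0) + z0)%C by ring. rewrite E. ring.
Qed.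

Lemma DW_unique_fixed z : open_disc z -> phi z = z -> z = z0.
Proof.
  intros Hz Hf. assert (Hi : forall n, Nat.iter n phi z = z).
  { induction n as [|n IH]; simpl; [easy|]. now rewrite IH. }
  assert (E : Cmod (z - z0)%C = 0).
  { apply Rle_antisym; [|apply Cmod_ge_0]. apply le_epsilon. intros eps He.
    destruct (DW_lim z eps Hz He) as [N HN]. specialize (HN N ltac:(lia)).
    rewrite Hi in HN. lra. }
  apply Cmod_eq_0 in E. replace z with ((z - z0) + z0)%C by ring. rewrite E. ring.
Qed.

Lemma DW_multiplier l : has_derivative phi z0 l -> Cmod l < 1.
Proof.
  intros Hl. unfold open_disc in z0_in.
  assert (Hin : forall x, Cmod (x - z0) < (1 - Cmod z0) / 2 -> Cmod x <= (1 + Cmod z0) / 2).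
  { intros x Hx. assert (T := Cmod_le_minus x z0). lra. }
  apply (attracting_multiplier phi z0 ((1 - Cmod z0) / 2)).
  - lra.
  - exact DW_fixed.
  - exact Hl.
  - intros n x Hx. apply iter_ex_derivative. specialize (Hin x Hx). unfold open_disc. lra.
  - intros eps He. destruct (DW_uniform ((1 + Cmod z0) / 2) eps) as [N HN]; [lra|assumption|].
    exists N. intros x Hx. apply HN; [lia|auto].
Qed.

(** If an iterate of [t] lies in the open disc, then by continuity the same iterate of all nearby
    points lies in one smaller closed disc, on which convergence is uniform. Compactness makes the
    threshold global. *)
Lemma uniform_attraction :
  (forall z, closed_disc z -> exists m, open_disc (Nat.iter m phi z)) ->
  forall eps, 0 < eps -> exists N, forall n z, (N <= n)%nat -> closed_disc z ->
    Cmod (Nat.iter n phi z - z0) < eps.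
Proof.
  intros Hent eps He.
  destruct (disc_eventually_uniform 1
    (fun N z => forall n, (N <= n)%nat -> Cmod (Nat.iter n phi z - z0) < eps)) as [N HN].
  - intros n m x Hnm H k Hk. apply H. lia.
  - intros t Ht. destruct (Hent t Ht) as [m Hm]. unfold open_disc in Hm.
    set (r := (1 + Cmod (Nat.iter m phi t)) / 2).
    destruct (DW_uniform r eps) as [N HN]; [unfold r; lra|assumption|].
    destruct (iter_continuous m t Ht ((1 - Cmod (Nat.iter m phi t)) / 2)) as (d & Hd & H); [lra|].
    exists (N + m)%nat, d. split; [assumption|]. intros x Hx Hxc n Hn.
    replace n with ((n - m) + m)%nat by lia. rewrite Nat.iter_add.
    apply HN; [lia|]. specialize (H x Hxc Hx).
    assert (T := Cmod_le_minus (Nat.iter m phi x) (Nat.iter m phi t)). unfold r. lra.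
  - exists N. intros n z Hn Hz. now apply HN.
Qed.

End Dynamics.

(** * Fixed points on the circle *)

(* The involutive automorphism of the disc exchanging [0] and [c]. *)
Definition mobius (c x : C) : C := ((c - x) * / (1 - Cconj c * x))%C.

Lemma C_minus_neq_0 (x y : C) : x <> y -> (x - y)%C <> 0%C.
Proof. intros H E. apply H. replace x with ((x - y) + y)%C by ring. rewrite E. ring. Qed.

Lemma mobius_denominator c x : open_disc c -> closed_disc x -> (1 - Cconj c * x)%C <> 0%C.
Proof.
  unfold open_disc, closed_disc. intros Hc Hx. apply C_minus_neq_0. intros E.
  apply (f_equal Cmod) in E. rewrite Cmod_1, Cmod_mult, Cmod_conj in E.
  assert (H1 := Cmod_ge_0 c). assert (H2 := Cmod_ge_0 x). nra.
Qed.

(** The right-hand side vanishes for [x] on the circle and is positive inside; hence both the circle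
    and the disc are preserved. *)
Lemma mobius_identity c x :
  Cmod (1 - Cconj c * x) ^ 2 - Cmod (c - x) ^ 2 = (1 - Cmod c ^ 2) * (1 - Cmod x ^ 2).
Proof. rewrite !Cmod2_alt. unfold Re, Im. simpl. ring. Qed.

Lemma Cmod_mobius c x : open_disc c -> closed_disc x ->
  0 < Cmod (1 - Cconj c * x) /\
  1 - Cmod (mobius c x) ^ 2 = (1 - Cmod c ^ 2) * (1 - Cmod x ^ 2) / Cmod (1 - Cconj c * x) ^ 2.
Proof.
  intros Hc Hx. assert (Hd := mobius_denominator c x Hc Hx).
  assert (Hd' : 0 < Cmod (1 - Cconj c * x)) by now apply Cmod_gt_0.
  split; [assumption|].
  rewrite <- mobius_identity. unfold mobius. rewrite Cmod_mult, Cmod_inv by assumption.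
  field. lra.
Qed.

Lemma mobius_open c x : open_disc c -> open_disc x -> open_disc (mobius c x).
Proof.
  intros Hc Hx. destruct (Cmod_mobius c x Hc (open_disc_closed x Hx)) as [Hd H].
  unfold open_disc in *. assert (H1 := Cmod_ge_0 c). assert (H2 := Cmod_ge_0 x).
  assert (0 < (1 - Cmod c ^ 2) * (1 - Cmod x ^ 2) / Cmod (1 - Cconj c * x) ^ 2).
  { apply Rdiv_lt_0_compat; [|now apply pow_lt]. apply Rmult_lt_0_compat; nra. }
  assert (H3 := Cmod_ge_0 (mobius c x)). nra.
Qed.

Lemma mobius_circle c x : open_disc c -> Cmod x = 1 -> Cmod (mobius c x) = 1.
Proof.
  intros Hc Hx. destruct (Cmod_mobius c x Hc) as [Hd H]; [unfold closed_disc; lra|].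
  rewrite Hx in H. replace (1 - 1 ^ 2) with 0 in H by ring.
  unfold Rdiv in H. rewrite Rmult_0_r, Rmult_0_l in H.
  assert (H3 := Cmod_ge_0 (mobius c x)). nra.
Qed.

Lemma mobius_closed c x : open_disc c -> closed_disc x -> closed_disc (mobius c x).
Proof.
  intros Hc [Hx|Hx].
  - now apply open_disc_closed, mobius_open.
  - right. now apply mobius_circle.
Qed.

Lemma mobius_involutive c x : open_disc c -> closed_disc x -> mobius c (mobius c x) = x.
Proof.
  intros Hc Hx. assert (Hd := mobius_denominator c x Hc Hx).
  assert (Hd' := mobius_denominator c c Hc (open_disc_closed c Hc)).
  unfold mobius. field. split; [assumption|].
  replace (1 - Cconj c * x - Cconj c * (c - x))%C with (1 - Cconj c * c)%C by ring. assumption.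
Qed.

Lemma mobius_0 c : mobius c 0%C = c.
Proof. unfold mobius. field. Qed.

Lemma mobius_self c : mobius c c = 0%C.
Proof. unfold mobius. ring. Qed.

Lemma mobius_has_derivative c x : open_disc c -> closed_disc x ->
  has_derivative (mobius c) x
    ((c * Cconj c - 1) / ((1 - Cconj c * x) * (1 - Cconj c * x)))%C.
Proof.
  intros Hc Hx. assert (Hd := mobius_denominator c x Hc Hx).
  assert (Hden : has_derivative (fun x => 1 - Cconj c * x)%C x (- Cconj c)%C).
  { apply (has_derivative_eq _ _ (0 - (0 * x + Cconj c * 1))%C); [|ring].
    apply has_derivative_minus; [apply has_derivative_const|].
    apply (has_derivative_mult (fun _ => Cconj c) (fun x => x));
      [apply has_derivative_const|apply has_derivative_id]. }
  eapply has_derivative_eq.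
  - apply (has_derivative_mult (fun x => c - x)%C (fun x => / (1 - Cconj c * x))%C).
    + apply has_derivative_minus; [apply has_derivative_const|apply has_derivative_id].
    + exact (has_derivative_inv _ x _ Hden Hd).
  - simpl. field. assumption.
Qed.

Lemma Re_inv (w : C) : Re (/ w)%C = Re w / (Re w ^ 2 + Im w ^ 2).
Proof. reflexivity. Qed.

(* With [u = y / x], [1 / (1 - u)] maps the unit circle minus [1] to the line [Re = 1/2]. *)
Lemma Re_cayley_circle (x y : C) : Cmod x = 1 -> Cmod y = 1 -> y <> x ->
  Re (x * / (x - y))%C = 1 / 2.
Proof.
  intros Hx Hy Hne.
  assert (Ex := Cmod2_alt x). assert (Ey := Cmod2_alt y). rewrite Hx in Ex. rewrite Hy in Ey.
  assert (Hp : 0 < Cmod (x - y) ^ 2).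
  { apply pow_lt, Cmod_gt_0, C_minus_neq_0. congruence. }
  rewrite Cmod2_alt in Hp.
  destruct x as [a b], y as [p q]. unfold Re, Im in *. simpl in *.
  set (D := (a + - p) * ((a + - p) * 1) + (b + - q) * ((b + - q) * 1)) in *.
  assert (E : a * (a + - p) + b * (b + - q) = D / 2) by (unfold D; lra).
  replace (a * _ - b * _) with ((a * (a + - p) + b * (b + - q)) / D) by (field; lra).
  rewrite E. field. lra.
Qed.

(** After clearing the denominator, the inequality is that the squared modulus of [l] is below 1. *)
Lemma Re_cayley_disc (l : C) : Cmod l < 1 -> 1 / 2 < Re (/ (1 - l))%C.
Proof.
  intros Hl. assert (E := Cmod2_alt l). assert (G := Cmod_ge_0 l).
  assert (H : Cmod l ^ 2 < 1) by nra. rewrite E in H.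
  rewrite Re_inv. destruct l as [a b]. unfold Re, Im in *. simpl in *.
  assert (a < 1) by nra.
  apply Rmult_lt_reg_r with ((1 + - a) * ((1 + - a) * 1) + (0 + - b) * ((0 + - b) * 1)); [nra|].
  unfold Rdiv. rewrite (Rmult_assoc (1 + - a)), Rinv_l by nra. nra.
Qed.

Section Boundary.
Variable phi : disc_algebra.
Hypothesis phi_closed : forall z, closed_disc z -> closed_disc (phi z).
Hypothesis phi_open : forall z, open_disc z -> open_disc (phi z).
Variable z0 : C.
Hypothesis z0_DW : Denjoy_Wolff_point phi z0.
Hypothesis z0_in : open_disc z0.
Hypothesis phi_circle : forall w, Cmod w = 1 -> Cmod (phi w) = 1.

(** Without a boundary fixed point, [G] is continuous up to the circle, where its real part is 1/2.
    Its limit at the centre has a larger real part, against [Re_center_le]. *)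
Lemma boundary_fixed_point : exists w, Cmod w = 1 /\ phi w = w.
Proof.
  apply NNPP; intros Hno.
  set (b := mobius z0). set (psi := fun x => b (phi (b x))).
  set (G := fun x => (x * / (x - psi x))%C).
  assert (fix0 : phi z0 = z0) by exact (DW_fixed phi phi_closed z0 z0_DW z0_in).
  assert (b_closed : forall x, closed_disc x -> closed_disc (b x)) by (intros; now apply mobius_closed).
  (* Fixed points of [psi] correspond to those of [phi] under [b]: in the open disc only [z0], sent
     to 0, and on the circle none. *)
  assert (psi_fix : forall x, closed_disc x -> x <> 0%C -> psi x <> x).
  { intros x Hx Hx0 E.
    assert (E' : phi (b x) = b x).
    { rewrite <- E at 2. symmetry. apply mobius_involutive; auto. }
    destruct Hx as [Hx|Hx].
    - apply Hx0. assert (H : b x = z0).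
      { apply (DW_unique_fixed phi z0 z0_DW); [|assumption]. now apply mobius_open. }
      assert (J := mobius_involutive z0 x z0_in (open_disc_closed x Hx)).
      change (b (b x) = x) in J. rewrite <- J, H. apply mobius_self.
    - apply Hno. exists (b x). split; [|assumption]. now apply mobius_circle. }
  destruct (da_has_derivative phi z0 z0_in) as [l Hl].
  assert (Hl1 : Cmod l < 1) by exact (DW_multiplier phi phi_closed phi_open z0 z0_DW z0_in l Hl).
  assert (b0 : b 0%C = z0) by apply mobius_0.
  assert (psi_0 : psi 0%C = 0%C).
  { unfold psi. rewrite b0, fix0. apply mobius_self. }
  (* Conjugation preserves the multiplier, as the derivatives of [b] at 0 and at [z0] are inverse to
     each other. *)
  assert (Dpsi : has_derivative psi 0 l).
  { assert (Hz : closed_disc z0) by now apply open_disc_closed.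
    assert (N1 := mobius_denominator z0 z0 z0_in Hz).
    eapply has_derivative_eq.
    - apply (has_derivative_comp b (fun x => phi (b x))).
      + apply (has_derivative_comp phi b).
        * apply mobius_has_derivative; [assumption|apply closed_disc_0].
        * rewrite b0. exact Hl.
      + rewrite b0, fix0. now apply mobius_has_derivative.
    - simpl. field. assumption. }
  assert (HRe := Re_cayley_disc l Hl1).
  set (eta := (Re (/ (1 - l))%C - 1 / 2) / 2). assert (Heta : 0 < eta) by (unfold eta; lra).
  (* Yields a collar along the circle on which [Re G] exceeds 1/2 by at most [eta], half the gap to
     be contradicted. *)
  destruct (disc_eventually_uniform 1
    (fun n x => 1 - / (INR n + 1) <= Cmod x -> Re (G x) <= 1 / 2 + eta)) as [N HN].
  - intros n m x Hnm H Hx. apply H. eapply Rle_trans; [|exact Hx].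
    apply Rplus_le_compat_l, Ropp_le_contravar, Rinv_le_contravar.
    + assert (P := pos_INR n). lra.
    + apply Rplus_le_compat_r. now apply le_INR.
  - intros t [Ht|Ht].
    (* Near an interior point the condition holds vacuously once the collar is thin enough. *)
    + destruct (archimed_cor1 ((1 - Cmod t) / 2)) as (n & Hn & Hn0); [lra|].
      exists n, ((1 - Cmod t) / 2). split; [lra|]. intros x Hx _ Hx'. exfalso.
      assert (T := Cmod_le_minus x t).
      assert (/ (INR n + 1) <= / INR n).
      { apply Rinv_le_contravar; [now apply lt_0_INR|lra]. }
      lra.
    + assert (Ht1 : closed_disc t) by (right; exact Ht).
      assert (Ht0 : t <> 0%C) by (apply Cmod_gt_0; lra).
      assert (HC : continuous_within closed_disc G t).
      { assert (Cb : forall x, closed_disc x -> continuous_within closed_disc b x).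
        { intros x Hx. eapply has_derivative_continuous. now apply mobius_has_derivative. }
        apply continuous_within_mult; [apply continuous_within_id|].
        apply continuous_within_inv.
        - apply continuous_within_minus; [apply continuous_within_id|].
          apply (continuous_within_comp closed_disc closed_disc b (fun x => phi (b x))).
          + apply (continuous_within_comp closed_disc closed_disc phi b); auto.
            apply da_continuous_within; auto.
          + auto.
          + auto.
        - apply C_minus_neq_0. intros E. now apply (psi_fix t). }
      destruct (HC eta Heta) as (d & Hd & H). exists O, d. split; [assumption|].
      intros x Hx Hxc _. specialize (H x Hxc Hx).
      assert (R1 := re_le_Cmod (G x - G t)).
      assert (R2 : Rabs (Re (G x - G t)) <= eta) by lra.
      apply Rabs_le_between in R2. change (Re (G x - G t)) with (Re (G x) - Re (G t)) in R2.
      assert (R3 : Re (G t) = 1 / 2).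
      { apply Re_cayley_circle; [assumption| |now apply psi_fix].
        apply mobius_circle; [assumption|]. apply phi_circle. now apply mobius_circle. }
      lra.
  - assert (P := pos_INR N).
    assert (Hinv : 0 < / (INR N + 1) <= 1).
    { split; [apply Rinv_0_lt_compat; lra|]. rewrite <- Rinv_1. apply Rinv_le_contravar; lra. }
    (* A radius inside the collar; halving keeps it positive even for [N = 0]. *)
    set (r := 1 - / (INR N + 1) / 2).
    enough (H : Re (/ (1 - l))%C <= 1 / 2 + eta) by (unfold eta in H; lra).
    apply (Re_center_le G (/ (1 - l))%C r).
    + intros x Hx. assert (Hxo : open_disc x) by apply Hx.
      assert (Hxc := open_disc_closed x Hxo).
      destruct (da_has_derivative phi (b x)) as [k Hk]; [now apply mobius_open|].
      eexists. apply has_derivative_mult; [apply has_derivative_id|].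
      apply has_derivative_inv.
      * apply has_derivative_minus; [apply has_derivative_id|].
        apply (has_derivative_comp b (fun x => phi (b x))).
        -- apply (has_derivative_comp phi b); [now apply mobius_has_derivative|exact Hk].
        -- apply mobius_has_derivative; auto.
      * apply C_minus_neq_0. intros E. apply (psi_fix x Hxc); [|easy].
        now apply Cmod_gt_0.
    + destruct Dpsi as (q & Eq & Cq & Hq).
      assert (HC : continuous_within (fun _ => True) (fun x => / (1 - q x))%C 0).
      { apply continuous_within_inv.
        - apply continuous_within_minus; [apply continuous_within_const|exact Cq].
        - rewrite Eq. apply C_minus_neq_0. intros E. rewrite <- E, Cmod_1 in Hl1. lra. }
      intros eps He. destruct (HC eps He) as (d & Hd & H).
      exists (Rmin d 1). split; [apply Rmin_case; lra|]. intros x [Hx0 Hx].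
      assert (Hx1 := Rlt_le_trans _ _ _ Hx (Rmin_l _ _)).
      assert (Hx2 := Rlt_le_trans _ _ _ Hx (Rmin_r _ _)).
      specialize (H x I). replace (x - 0)%C with x in H by ring. specialize (H Hx1).
      rewrite Eq in H. apply Cmod_gt_0 in Hx0.
      assert (Ep : psi x = (q x * x)%C).
      { specialize (Hq x). rewrite psi_0 in Hq.
        replace (psi x) with (psi x - 0)%C by ring. rewrite Hq. ring. }
      assert (Hne : (x - psi x)%C <> 0%C).
      { apply C_minus_neq_0. intros E. apply (psi_fix x); auto.
        left. exact Hx2. }
      rewrite Ep in Hne.
      replace (G x) with (/ (1 - q x))%C; [exact H|]. unfold G. rewrite Ep. field.
      split; [assumption|]. intros E. apply Hne.
      replace (x - q x * x)%C with ((1 - q x) * x)%C by ring. rewrite E. ring.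
    + unfold r. lra.
    + intros x Hx. apply HN; rewrite Hx; unfold r; lra.
Qed.

End Boundary.

(** * Cesaro means *)

Section Operators.
Context {X : NormedModule C_AbsRing}.
Variable T : bounded_operator X.

Lemma iter_scal n (c : C_AbsRing) (x : X) :
  Nat.iter n T (scal c x) = scal c (Nat.iter n T x).
Proof.
  induction n as [|n IH]; [easy|]. simpl. rewrite IH. apply linear_scal, op_bounded.
Qed.

Lemma cesaro_mean_scal n (c : C_AbsRing) (x : X) :
  cesaro_mean T n (scal c x) = scal c (cesaro_mean T n x).
Proof.
  unfold cesaro_mean.
  rewrite (sum_n_m_ext _ (fun m => scal c (Nat.iter m T x))) by (intros; apply iter_scal).
  rewrite sum_n_m_scal_l, !scal_assoc. f_equal. apply Cmult_comm.
Qed.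

(** Dividing by [norm x + 1] instead of [norm x] brings [x] into the unit ball without a separate
    case for zero. *)
Lemma op_norm_bound (D : X -> X) (eps : R) :
  (forall (c : C_AbsRing) x, D (scal c x) = scal c (D x)) ->
  Rbar_lt (op_norm D) eps -> forall x, norm (D x) <= (norm x + 1) * eps.
Proof.
  intros HD Heps x.
  assert (Hx : 0 < norm x + 1) by (assert (H := norm_ge_0 x); lra).
  set (c := RtoC (/ (norm x + 1)) : C_AbsRing). set (d := RtoC (norm x + 1) : C_AbsRing).
  assert (Habs : forall r, 0 <= r -> abs (RtoC r : C_AbsRing) = r).
  { intros r Hr. change (Cmod r = r). rewrite Cmod_R. now apply Rabs_pos_eq. }
  assert (Hc : norm (scal c x) <= 1).
  { eapply Rle_trans; [apply norm_scal|]. unfold c.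
    rewrite Habs by (left; now apply Rinv_0_lt_compat).
    apply Rmult_le_reg_l with (norm x + 1); [assumption|].
    rewrite <- Rmult_assoc, Rinv_r by lra. lra. }
  assert (Hlub : Rbar_le (norm (D (scal c x))) (op_norm D)).
  { apply (proj1 (Lub_Rbar_correct _)). now exists (scal c x). }
  assert (Hlt : norm (D (scal c x)) < eps) by exact (Rbar_le_lt_trans _ _ _ Hlub Heps).
  assert (E : D x = scal d (D (scal c x))).
  { rewrite HD, scal_assoc. replace (mult d c) with (one : C_AbsRing); [now rewrite scal_one|].
    change (RtoC 1 = (d * c)%C). unfold c, d. rewrite <- RtoC_mult. f_equal. field. lra. }
  rewrite E. eapply Rle_trans; [apply norm_scal|]. unfold d. rewrite Habs by lra.
  apply Rmult_le_compat_l; lra.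
Qed.

Lemma uniformly_mean_ergodic_mean_ergodic : uniformly_mean_ergodic T -> mean_ergodic T.
Proof.
  intros [P HP]. exists P. intros x.
  apply (filterlim_locally (F := eventually)). intros eps.
  assert (Hx : 0 < norm x + 1) by (assert (H := norm_ge_0 x); lra).
  assert (He : 0 < eps / (norm x + 1) / 2).
  { apply Rdiv_lt_0_compat; [|lra]. apply Rdiv_lt_0_compat; [apply cond_pos|assumption]. }
  specialize (HP (mkposreal _ He)). revert HP. apply filter_imp. intros n Hn.
  apply norm_compat1.
  eapply Rle_lt_trans.
  - apply (op_norm_bound (fun x => minus (cesaro_mean T n x) (P x))); [|exact Hn].
    intros c y. rewrite cesaro_mean_scal, (linear_scal P (op_bounded _ P)).
    symmetry. apply (scal_minus_distr_l (V := NormedModule.ModuleSpace C_AbsRing X) c).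
  - simpl. replace ((norm x + 1) * (eps / (norm x + 1) / 2)) with (eps / 2) by (field; lra).
    assert (H := cond_pos eps). lra.
Qed.

End Operators.

(** At most [N] terms are charged [M], the others [eps]; the bound depends on the sequence only
    through these numbers, which gives uniformity in [f] and [z] later. *)
Lemma cesaro_bound (a : nat -> C) (l : C) (M eps : R) (N : nat) :
  0 <= M -> 0 <= eps ->
  (forall m, Cmod (a m - l) <= M) -> (forall m, (N <= m)%nat -> Cmod (a m - l) <= eps) ->
  forall n, (1 <= n)%nat ->
    Cmod (RtoC (/ INR n) * sum_n_m a 1 n - l) <= M * INR N / INR n + eps.
Proof.
  intros HM He Ha HN n Hn.
  (* The minimum counts the terms charged [M], so that the induction also covers [n < N]. *)
  assert (H : forall n, Cmod (sum_n_m a 1 n - INR n * l)%C <= M * INR (Nat.min n N) + INR n * eps).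
  { clear n Hn. induction n as [|n IH].
    - rewrite sum_n_m_zero by lia. change (zero : C_AbelianMonoid) with (RtoC 0).
      simpl. replace (0 - 0 * l)%C with (RtoC 0) by ring. rewrite Cmod_0. lra.
    - rewrite sum_n_Sm by lia. change (@plus C_AbelianMonoid) with Cplus.
      replace (sum_n_m a 1 n + a (S n) - INR (S n) * l)%C
        with ((sum_n_m a 1 n - INR n * l) + (a (S n) - l))%C
        by (rewrite S_INR, RtoC_plus; ring).
      eapply Rle_trans; [apply Cmod_triangle|].
      rewrite (S_INR n).
      destruct (Nat.le_gt_cases N (S n)) as [HSn|HSn].
      + specialize (HN (S n) HSn).
        assert (INR (Nat.min n N) <= INR (Nat.min (S n) N)) by (apply le_INR; lia). nra.
      + rewrite (Nat.min_l (S n)) by lia. rewrite (Nat.min_l n) in IH by lia.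
        specialize (Ha (S n)). rewrite S_INR. lra. }
  specialize (H n).
  assert (Pn : 0 < INR n) by (apply lt_0_INR; lia).
  assert (Hne : RtoC (INR n) <> 0%C) by (intros E; injection E; lra).
  replace (RtoC (/ INR n) * sum_n_m a 1 n - l)%C
    with (RtoC (/ INR n) * (sum_n_m a 1 n - INR n * l))%C
    by (rewrite RtoC_inv by lra; field; assumption).
  rewrite Cmod_mult, Cmod_R, Rabs_pos_eq by (left; now apply Rinv_0_lt_compat).
  assert (INR (Nat.min n N) <= INR N) by (apply le_INR; lia).
  apply Rmult_le_reg_l with (INR n); [assumption|].
  rewrite <- Rmult_assoc, Rinv_r, Rmult_1_l by lra.
  replace (INR n * (M * INR N / INR n + eps)) with (M * INR N + INR n * eps) by (field; lra).
  eapply Rle_trans; [exact H|]. nra.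
Qed.

Lemma Re_cesaro_le (a : nat -> C) (c : R) : (forall m, Re (a m) <= c) ->
  forall n, (1 <= n)%nat -> Re (RtoC (/ INR n) * sum_n_m a 1 n)%C <= c.
Proof.
  intros Ha n Hn.
  assert (H : forall n, Re (sum_n_m a 1 n) <= INR n * c).
  { clear n Hn. induction n as [|n IH].
    - rewrite sum_n_m_zero by lia. simpl. lra.
    - rewrite sum_n_Sm by lia. rewrite S_INR. specialize (Ha (S n)).
      change (Re (plus (sum_n_m a 1 n) (a (S n)))) with (Re (sum_n_m a 1 n) + Re (a (S n))). lra. }
  specialize (H n).
  assert (Pn : 0 < INR n) by (apply lt_0_INR; lia).
  replace (Re (RtoC (/ INR n) * sum_n_m a 1 n)%C) with (/ INR n * Re (sum_n_m a 1 n))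
    by (unfold Re; simpl; ring).
  apply Rmult_le_reg_l with (INR n); [assumption|].
  rewrite <- Rmult_assoc, Rinv_r, Rmult_1_l by lra. exact H.
Qed.

Lemma cesaro_lim (a : nat -> C) (l : C) (M : R) :
  (forall m, Cmod (a m - l) <= M) ->
  (forall eps, 0 < eps -> exists N, forall m, (N <= m)%nat -> Cmod (a m - l) < eps) ->
  forall eps, 0 < eps -> exists N, forall n, (N <= n)%nat ->
    Cmod (RtoC (/ INR n) * sum_n_m a 1 n - l) < eps.
Proof.
  intros Ha Hl eps He. destruct (Hl (eps / 2)) as [N HN]; [lra|].
  assert (HM : 0 <= M) by (eapply Rle_trans; [apply Cmod_ge_0|apply (Ha 0%nat)]).
  destruct (nfloor_ex (M * INR N / (eps / 2))) as [K [_ HK]].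
  { apply Rmult_le_pos; [|left; apply Rinv_0_lt_compat; lra].
    apply Rmult_le_pos; [assumption|apply pos_INR]. }
  (* Beyond [K] the first term of the bound is below [eps / 2]; the successor also excludes
     [n = 0]. *)
  exists (S K). intros n Hn.
  assert (Hn' : INR K + 1 <= INR n) by (rewrite <- S_INR; now apply le_INR).
  assert (PK := pos_INR K).
  eapply Rle_lt_trans.
  - apply (cesaro_bound a l M (eps / 2) N); [assumption|lra|assumption| |lia].
    intros m Hm. left. now apply HN.
  - assert (M * INR N / INR n < eps / 2); [|lra].
    apply Rmult_lt_reg_r with (INR n); [lra|].
    unfold Rdiv at 1. rewrite Rmult_assoc, Rinv_l, Rmult_1_r by lra.
    assert (HK' : M * INR N < (INR K + 1) * (eps / 2)).
    { replace (M * INR N) with (M * INR N / (eps / 2) * (eps / 2)) by (field; lra).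
      apply Rmult_lt_compat_r; lra. }
    nra.
Qed.

(** * Elements of the disc algebra and Lipschitz estimates *)

Definition da_restrict (f : C -> C)
    (Hc : forall z, closed_disc z -> continuous_within closed_disc f z)
    (Hd : forall z, open_disc z -> exists l, has_derivative f z l) : disc_algebra.
Proof.
  refine (mk_disc_algebra (fun z => if Rle_dec (Cmod z) 1 then f z else 0%C) _ _ _).
  - intros z Hz. apply continuous_within_filterlim.
    intros eps He. destruct (Hc z Hz eps He) as (d & Pd & H). exists d. split; [assumption|].
    intros x Hx Hxd. destruct (Rle_dec (Cmod z) 1) as [_|n]; [|now destruct n].
    destruct (Rle_dec (Cmod x) 1) as [_|n]; [auto|now destruct n].
  - intros z Hz. destruct (Hd z Hz) as [l Hl].
    apply ex_derive_ext_loc with (f := f).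
    + generalize (closed_disc_nbhs z Hz); apply filter_imp.
      intros x Hx. destruct (Rle_dec (Cmod x) 1) as [_|n]; [easy|now destruct n].
    + exists l. now apply is_derive_of_has_derivative.
  - intros z Hz. destruct (Rle_dec (Cmod z) 1) as [H|_]; [now destruct Hz|easy].
Defined.

Lemma da_restrict_eq f Hc Hd z : closed_disc z -> da_restrict f Hc Hd z = f z.
Proof. intros Hz. simpl. destruct (Rle_dec (Cmod z) 1) as [_|n]; [easy|now destruct n]. Qed.

Definition da_const (c : C) : disc_algebra :=
  da_restrict (fun _ => c) (fun z _ => continuous_within_const closed_disc c z)
    (fun z _ => ex_intro _ _ (has_derivative_const c z)).

Definition da_id : disc_algebra :=
  da_restrict (fun z => z) (fun z _ => continuous_within_id closed_disc z)
    (fun z _ => ex_intro _ _ (has_derivative_id z)).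

(** The limit of the means: a projection onto the constant functions. *)
Definition evaluation (z0 : C) (f : disc_algebra) : disc_algebra := da_const (f z0).

Lemma evaluation_linear z0 : open_disc z0 ->
  is_linear (K := C_AbsRing) (U := da_NormedModule) (V := da_NormedModule) (evaluation z0).
Proof.
  intros Hz0. split.
  - intros f g. apply disc_algebra_ext. intros z Hz. simpl.
    destruct (Rle_dec (Cmod z) 1); [easy|ring].
  - intros k f. apply disc_algebra_ext. intros z Hz. simpl.
    destruct (Rle_dec (Cmod z) 1); [easy|ring].
  - exists 1. split; [lra|]. intros f. rewrite Rmult_1_l.
    apply (sup_norm_le (evaluation z0 f)). intros z Hz. unfold evaluation, da_const.
    rewrite da_restrict_eq by assumption. apply Cmod_le_sup_norm. now apply open_disc_closed.
Qed.

Definition evaluation_operator z0 (Hz0 : open_disc z0) : bounded_operator da_NormedModule :=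
  mk_bounded_operator (evaluation z0 : da_NormedModule -> da_NormedModule)
    (evaluation_linear z0 Hz0).

(** Pairing with the increment [Delta] makes the problem real: [u 1 - u 0] is the squared modulus of
    [Delta], and the real mean value theorem applies to [u]. *)
Lemma segment_mean_value f p h K :
  (forall t, 0 <= t <= 1 -> exists l, has_derivative f (p + RtoC t * h)%C l /\ Cmod l <= K) ->
  Cmod (f (p + h) - f p)%C <= K * Cmod h.
Proof.
  intros Hf. set (Delta := (f (p + h) - f p)%C).
  set (g := fun z => (Cconj Delta * f z)%C).
  set (u := fun t : R => Re (g (p + RtoC t * h)%C)).
  assert (Hu : forall t, 0 <= t <= 1 -> exists k, derivable_pt_lim u t k /\ k <= Cmod Delta * (K * Cmod h)).
  { intros t Ht. destruct (Hf t Ht) as (l & Hl & HK).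
    assert (Hg : has_derivative g (p + RtoC t * h)%C (0 * f (p + RtoC t * h) + Cconj Delta * l)%C).
    { apply (has_derivative_mult (fun _ => Cconj Delta) f); [apply has_derivative_const|exact Hl]. }
    apply (has_derivative_eq _ _ _ (Cconj Delta * l)%C) in Hg; [|ring].
    assert (E : forall s, (p + RtoC s * h)%C = (fst p + s * fst h, snd p + s * snd h)).
    { intros s. apply injective_projections; simpl; ring. }
    rewrite E in Hg. apply has_derivative_differentiable in Hg. destruct Hg as [Hg _].
    eexists. split.
    - apply (derivable_pt_lim_ext (fun s => Re (g (fst p + s * fst h, snd p + s * snd h)))).
      { intros s. unfold u. now rewrite E. }
      apply (derivable_pt_lim_comp_2d (fun u v => Re (g (u, v)))
        (fun s => fst p + s * fst h) (fun s => snd p + s * snd h) t _ _ (fst h) (snd h) Hg).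
      + apply is_derive_Reals. auto_derive; [easy|ring].
      + apply is_derive_Reals. auto_derive; [easy|ring].
    - replace (_ + _) with (Re (Cconj Delta * l * h)%C) by (unfold Re, Im; simpl; ring).
      eapply Rle_trans; [apply Rle_abs|]. eapply Rle_trans; [apply re_le_Cmod|].
      rewrite !Cmod_mult, Cmod_conj, Rmult_assoc.
      apply Rmult_le_compat_l; [apply Cmod_ge_0|].
      apply Rmult_le_compat_r; [apply Cmod_ge_0|assumption]. }
  destruct (MVT_gen u 0 1 (fun t => Derive u t)) as (c & Hc & E).
  - rewrite Rmin_left, Rmax_right by lra. intros t Ht.
    destruct (Hu t ltac:(lra)) as (k & Hk & _). apply Derive_correct. exists k.
    now apply is_derive_Reals.
  - rewrite Rmin_left, Rmax_right by lra. intros t Ht.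
    destruct (Hu t ltac:(lra)) as (k & Hk & _). apply derivable_continuous_pt. now exists k.
  - rewrite Rmin_left, Rmax_right in Hc by lra.
    destruct (Hu c Hc) as (k & Hk & HK). apply is_derive_Reals, is_derive_unique in Hk.
    rewrite Hk in E.
    assert (E2 : u 1 - u 0 = Cmod Delta ^ 2).
    { unfold u, g. replace (p + RtoC 1 * h)%C with (p + h)%C by ring.
      replace (p + RtoC 0 * h)%C with p by ring.
      transitivity (Re (Cconj Delta * (f (p + h) - f p))%C); [unfold Re; simpl; ring|].
      fold Delta. rewrite Cmod2_alt. unfold Re, Im. simpl. ring. }
    rewrite E2 in E.
    assert (G := Cmod_ge_0 Delta).
    destruct (Req_dec (Cmod Delta) 0) as [E0|E0].
    + rewrite E0. destruct (Hf 0) as (l & _ & Hl); [lra|].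
      apply Rmult_le_pos; [|apply Cmod_ge_0]. eapply Rle_trans; [apply Cmod_ge_0|exact Hl].
    + apply Rmult_le_reg_l with (Cmod Delta); [lra|]. simpl in E. lra.
Qed.

(** Discs of radius [rho] around points of the segment stay in the unit disc, so Cauchy's estimate
    bounds the derivative along it. The constant depends on [f] only through its norm. *)
Lemma da_Lipschitz (f : disc_algebra) p rho : 0 < rho -> Cmod p + 2 * rho <= 1 ->
  forall x, Cmod (x - p) <= rho ->
    Cmod (f x - f p) <= 4 * sup_norm f / rho * Cmod (x - p).
Proof.
  intros Hrho Hp x Hx.
  replace (f x) with (f (p + (x - p))%C) by (f_equal; ring).
  apply segment_mean_value. intros t Ht.
  set (y := (p + RtoC t * (x - p))%C).
  assert (Hy : Cmod y <= Cmod p + rho).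
  { unfold y. eapply Rle_trans; [apply Cmod_triangle|]. apply Rplus_le_compat_l.
    rewrite Cmod_mult, Cmod_R, Rabs_pos_eq by lra. assert (G := Cmod_ge_0 (x - p)). nra. }
  assert (Hball : forall z, Cmod (z - y) < rho -> open_disc z).
  { intros z Hz. assert (H := Cmod_le_minus z y). unfold open_disc. lra. }
  destruct (da_has_derivative f y) as [l Hl].
  { unfold open_disc. lra. }
  exists l. split; [exact Hl|].
  apply (Cauchy_derivative_estimate f y); auto.
  - intros z Hz. apply da_has_derivative. auto.
  - intros z Hz. apply Cmod_le_sup_norm. apply open_disc_closed. auto.
Qed.

(** * Ergodicity of the composition operator *)

Lemma poisson_denominator (a x : C) : 1 < Cmod a -> closed_disc x -> (a - x)%C <> 0%C.
Proof. intros Ha Hx. apply C_minus_neq_0. intros ->. unfold closed_disc in Hx. lra. Qed.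

Lemma poisson_has_derivative (a x : C) : 1 < Cmod a -> closed_disc x ->
  exists l, has_derivative (fun x => (a + x) * / (a - x))%C x l.
Proof.
  intros Ha Hx. eexists. apply has_derivative_mult.
  - apply (has_derivative_plus (fun _ => a) (fun x => x)); [apply has_derivative_const|apply has_derivative_id].
  - apply has_derivative_inv; [|now apply poisson_denominator].
    apply (has_derivative_minus (fun _ => a) (fun x => x)); [apply has_derivative_const|apply has_derivative_id].
Qed.

(** Its real part is the Poisson kernel of the disc of radius [Cmod a] with boundary point [a].
    Taking [a] outside the closed unit disc keeps the function in the disc algebra. *)
Definition da_poisson (a : C) (Ha : 1 < Cmod a) : disc_algebra.
Proof.
  refine (da_restrict (fun x => (a + x) * / (a - x))%C _ _).
  - intros z Hz. destruct (poisson_has_derivative a z Ha Hz) as [l Hl].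
    exact (has_derivative_continuous _ _ _ _ Hl).
  - intros z Hz. apply poisson_has_derivative; [exact Ha|now apply open_disc_closed].
Defined.

Lemma Re_poisson (a x : C) : (a - x)%C <> 0%C ->
  Re ((a + x) * / (a - x))%C = (Cmod a ^ 2 - Cmod x ^ 2) / Cmod (a - x) ^ 2.
Proof.
  intros Hne. assert (Hp : 0 < Cmod (a - x) ^ 2) by now apply pow_lt, Cmod_gt_0.
  rewrite !Cmod2_alt in *. destruct a as [a b], x as [p q]. unfold Re, Im in *. simpl in *.
  field. lra.
Qed.

Section MeanErgodic.
Variable phi : disc_algebra.
Hypothesis phi_closed : forall z, closed_disc z -> closed_disc (phi z).
Hypothesis phi_open : forall z, open_disc z -> open_disc (phi z).
Variable z0 : C.
Hypothesis z0_DW : Denjoy_Wolff_point phi z0.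
Hypothesis z0_in : open_disc z0.

Let C_phi := composition_operator phi phi_closed phi_open.

Lemma iter_composition n (f : disc_algebra) z : closed_disc z ->
  (Nat.iter n C_phi f : disc_algebra) z = f (Nat.iter n phi z).
Proof.
  revert z. induction n as [|n IH]; intros z Hz; [easy|].
  rewrite (Nat.iter_succ_r n C phi z).
  transitivity ((Nat.iter n C_phi f : disc_algebra) (phi z)).
  - simpl. destruct (Rle_dec (Cmod z) 1) as [_|m]; [easy|now destruct m].
  - now apply IH, phi_closed.
Qed.

Lemma cesaro_composition n (f : disc_algebra) z : closed_disc z ->
  (cesaro_mean C_phi n f : disc_algebra) z =
  (RtoC (/ INR n) * sum_n_m (fun m => f (Nat.iter m phi z)) 1 n)%C.
Proof.
  intros Hz.
  change ((cesaro_mean C_phi n f : disc_algebra) z) with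
    (RtoC (/ INR n) * (sum_n_m (G := da_AbelianMonoid) (fun m => Nat.iter m C_phi f) 1 n : disc_algebra) z)%C.
  f_equal. generalize n. clear n. induction n as [|n IH].
  - rewrite !sum_n_m_zero by lia. reflexivity.
  - rewrite !sum_n_Sm by lia.
    change (@plus C_AbelianMonoid) with Cplus. rewrite <- IH, <- iter_composition by assumption.
    reflexivity.
Qed.

Lemma mean_ergodic_pointwise (P : bounded_operator da_NormedModule) (f : disc_algebra) :
  filterlim (fun n => cesaro_mean C_phi n f) eventually (locally (P f)) ->
  forall z eps, closed_disc z -> 0 < eps -> exists N, forall n, (N <= n)%nat ->
    Cmod (RtoC (/ INR n) * sum_n_m (fun m => f (Nat.iter m phi z)) 1 n - (P f : disc_algebra) z)%C < eps.
Proof.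
  intros H z eps Hz He.
  destruct (proj1 (filterlim_locally (F := eventually) _ _) H (mkposreal eps He)) as [N HN].
  exists N. intros n Hn. specialize (HN n Hn).
  change (sup_norm (minus (cesaro_mean C_phi n f) (P f) : disc_algebra) < eps) in HN.
  eapply Rle_lt_trans; [|exact HN].
  eapply Rle_trans; [|exact (Cmod_le_sup_norm _ z Hz)].
  rewrite <- cesaro_composition by assumption. apply Req_le. f_equal. simpl. ring.
Qed.

Lemma mean_ergodic_limit (P : bounded_operator da_NormedModule) (f : disc_algebra) :
  filterlim (fun n => cesaro_mean C_phi n f) eventually (locally (P f)) ->
  forall z, closed_disc z -> (P f : disc_algebra) z = f z0.
Proof.
  intros H.
  assert (Hopen : forall z, open_disc z -> (P f : disc_algebra) z = f z0).
  { intros z Hz. assert (Hc := open_disc_closed z Hz).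
    assert (Hz0 := open_disc_closed z0 z0_in).
    assert (E : Cmod ((P f : disc_algebra) z - f z0)%C = 0).
    { apply Rle_antisym; [|apply Cmod_ge_0]. apply le_epsilon. intros eps He.
      destruct (mean_ergodic_pointwise P f H z (eps / 2) Hc) as [N1 H1]; [lra|].
      destruct (cesaro_lim (fun m => f (Nat.iter m phi z)) (f z0) (sup_norm f + sup_norm f))
        with (eps := eps / 2) as [N2 H2].
      - intros m. eapply Rle_trans; [apply Cmod_triangle|]. rewrite Cmod_opp.
        apply Rplus_le_compat; apply Cmod_le_sup_norm; [|assumption].
        now apply iter_closed.
      - intros e Hpe. destruct (da_continuous_within f z0 Hz0 e Hpe) as (d & Hd & Hf).
        destruct (DW_lim phi z0 z0_DW z d Hz Hd) as [N HN].
        exists N. intros m Hm. apply Hf; [|now apply HN]. now apply iter_closed.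
      - lra.
      - set (n := Nat.max N1 N2). specialize (H1 n ltac:(lia)). specialize (H2 n ltac:(lia)).
        rewrite Cmod_minus_sym in H1.
        eapply Rle_trans; [eapply Cmod_minus_triangle|]. rewrite Rplus_0_l. left.
        eapply Rlt_le_trans; [apply Rplus_lt_compat; [exact H1|exact H2]|]. lra. }
    apply Cmod_eq_0 in E.
    replace ((P f : disc_algebra) z) with (((P f : disc_algebra) z - f z0) + f z0)%C by ring.
    rewrite E. ring. }
  intros z Hz.
  assert (E : Cmod ((P f : disc_algebra) z - f z0)%C = 0).
  { apply Rle_antisym; [|apply Cmod_ge_0]. apply le_epsilon. intros eps He.
    destruct (da_continuous_within (P f) z Hz eps He) as (d & Hd & Hf).
    (* The point [z] is approached radially by [(1 - t) * z], which lies in the open disc and within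
       [d] of [z]. *)
    set (t := Rmin (d / 2) (1 / 2)).
    assert (Ht1 := Rmin_l (d / 2) (1 / 2)). assert (Ht2 := Rmin_r (d / 2) (1 / 2)).
    assert (Ht0 : 0 < t) by (apply Rmin_case; lra). fold t in Ht1, Ht2.
    assert (G := Cmod_ge_0 z). unfold closed_disc in Hz.
    assert (Ho : open_disc (RtoC (1 - t) * z)%C).
    { unfold open_disc. rewrite Cmod_mult, Cmod_R, Rabs_pos_eq by lra. nra. }
    specialize (Hf (RtoC (1 - t) * z)%C (open_disc_closed _ Ho)).
    rewrite Hopen in Hf by assumption. rewrite Cmod_minus_sym. left.
    apply Rlt_le_trans with eps; [|lra]. apply Hf.
    replace (RtoC (1 - t) * z - z)%C with (- (RtoC t * z))%C by (rewrite RtoC_minus; ring).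
    rewrite Cmod_opp, Cmod_mult, Cmod_R, Rabs_pos_eq by lra. nra. }
  apply Cmod_eq_0 in E.
  replace ((P f : disc_algebra) z) with (((P f : disc_algebra) z - f z0) + f z0)%C by ring.
  rewrite E. ring.
Qed.

Lemma mean_ergodic_averages : mean_ergodic C_phi ->
  forall (f : disc_algebra) z eps, closed_disc z -> 0 < eps -> exists n, (1 <= n)%nat /\
    Cmod (RtoC (/ INR n) * sum_n_m (fun m => f (Nat.iter m phi z)) 1 n - f z0)%C < eps.
Proof.
  intros [P HP] f z eps Hz He. specialize (HP f).
  destruct (mean_ergodic_pointwise P f HP z eps Hz He) as [N HN].
  rewrite (mean_ergodic_limit P f HP z Hz) in HN.
  exists (S N). split; [lia|]. apply HN. lia.
Qed.

Lemma mean_ergodic_no_boundary_fixed_point : mean_ergodic C_phi ->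
  forall w, Cmod w = 1 -> phi w <> w.
Proof.
  intros Hme w Hw Hfix.
  assert (Hwc : closed_disc w) by (right; exact Hw).
  assert (Hz0 := open_disc_closed z0 z0_in). unfold open_disc in z0_in.
  (* The tolerance is smaller than the distance from [w] to [z0], which is at least
     [1 - Cmod z0]. *)
  destruct (mean_ergodic_averages Hme da_id w ((1 - Cmod z0) / 2) Hwc) as (n & Hn & H); [lra|].
  assert (Hi : forall m, Nat.iter m phi w = w).
  { induction m as [|m IH]; simpl; [easy|]. now rewrite IH. }
  assert (Eid : forall x, closed_disc x -> da_id x = x) by (intros; now apply da_restrict_eq).
  assert (Ha : forall m, Cmod (da_id (Nat.iter m phi w) - w)%C <= 0).
  { intros m. rewrite Hi, Eid by assumption. replace (w - w)%C with (RtoC 0) by ring.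
    rewrite Cmod_0. lra. }
  (* Zero bounds express that the mean of the constant sequence [w] is [w]. *)
  assert (B := cesaro_bound _ w 0 0 0 ltac:(lra) ltac:(lra) Ha (fun m _ => Ha m) n Hn).
  rewrite Eid in H by assumption.
  set (s := (RtoC (/ INR n) * sum_n_m (fun m => da_id (Nat.iter m phi w)) 1 n)%C) in *.
  assert (T1 := Cmod_minus_triangle w s z0). rewrite (Cmod_minus_sym w s) in T1.
  assert (T2 := Cmod_le_minus w z0). simpl in B.
  unfold Rdiv in B. lra.
Qed.

(* A boundary arc around a point whose orbit enters the disc is never visited by
   an orbit staying on the circle; the Poisson kernel concentrated on that arc
   is then small along the orbit but not at [z0]. *)
Lemma mean_ergodic_circle_invariant : mean_ergodic C_phi ->
  forall z, (forall k, Cmod (Nat.iter k phi z) = 1) ->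
  forall w, Cmod w = 1 -> Cmod (phi w) = 1.
Proof.
  intros Hme z Hz w Hw. apply NNPP. intros Hne.
  assert (Hwc : closed_disc w) by (right; exact Hw).
  assert (Hlt : Cmod (phi w) < 1) by (destruct (phi_closed w Hwc); [assumption|contradiction]).
  (* Points of the closed disc within [d] of [w] are mapped into the open disc, so the orbit keeps
     distance [d] from [w]. *)
  destruct (da_continuous_within phi w Hwc (1 - Cmod (phi w))) as (d & Hd & Hcont); [lra|].
  assert (Hfar : forall k, d <= Cmod (Nat.iter k phi z - w)).
  { intros k. apply Rnot_lt_le. intros Hk.
    assert (Hc : closed_disc (Nat.iter k phi z)) by (right; apply Hz).
    specialize (Hcont _ Hc Hk). assert (T := Cmod_le_minus (phi (Nat.iter k phi z)) (phi w)).
    specialize (Hz (S k)). simpl in Hz. lra. }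
  assert (Hz0 := open_disc_closed z0 z0_in). unfold open_disc in z0_in.
  assert (G0 := Cmod_ge_0 z0).
  (* A lower bound for the kernel at [z0]: its numerator is at least [1 - Cmod z0 ^ 2], and [a] is
     within 3 of [z0]. *)
  set (kappa := (1 - Cmod z0 ^ 2) / 9).
  assert (Hk : 0 < kappa) by (unfold kappa; nra).
  (* [e <= 1] gives the distance 3 above; [e <= d / 2] keeps [a] at distance [d / 2] from the orbit;
     the last bound makes the numerator on the circle, at most [3 * e], small enough for the kernel
     to stay below [kappa / 2] along the orbit. *)
  set (e := Rmin (Rmin 1 (d / 2)) (kappa * d ^ 2 / 24)).
  assert (Hd2 : 0 < d ^ 2) by now apply pow_lt.
  assert (He0 : 0 < e).
  { apply Rmin_case; [apply Rmin_case; lra|]. apply Rdiv_lt_0_compat; [|lra].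
    now apply Rmult_lt_0_compat. }
  assert (He1 : e <= 1) by (eapply Rle_trans; [apply Rmin_l|apply Rmin_l]).
  assert (He2 : e <= d / 2) by (eapply Rle_trans; [apply Rmin_l|apply Rmin_r]).
  assert (He3 : e <= kappa * d ^ 2 / 24) by apply Rmin_r.
  set (a := (RtoC (1 + e) * w)%C).
  assert (Ea : Cmod a = 1 + e) by (unfold a; rewrite Cmod_mult, Cmod_R, Rabs_pos_eq, Hw by lra; ring).
  assert (Ha : 1 < Cmod a) by lra.
  assert (Eaw : Cmod (a - w) = e).
  { replace (a - w)%C with (RtoC e * w)%C by (unfold a; rewrite RtoC_plus; ring).
    rewrite Cmod_mult, Cmod_R, Rabs_pos_eq, Hw by lra. ring. }
  set (f := da_poisson a Ha).
  assert (Ef : forall x, closed_disc x -> Re (f x) = (Cmod a ^ 2 - Cmod x ^ 2) / Cmod (a - x) ^ 2).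
  { intros x Hx. unfold f, da_poisson. rewrite da_restrict_eq by assumption.
    apply Re_poisson. now apply poisson_denominator. }
  assert (Hsmall : forall k, Re (f (Nat.iter k phi z)) <= kappa / 2).
  { intros k. rewrite Ef by (right; apply Hz). rewrite Hz, Ea.
    assert (T := Cmod_minus_triangle (Nat.iter k phi z) a w). specialize (Hfar k).
    rewrite (Cmod_minus_sym _ a), Eaw in T.
    assert (Hq : (d / 2) ^ 2 <= Cmod (a - Nat.iter k phi z) ^ 2) by (apply pow_incr; lra).
    assert (Hp : 0 < Cmod (a - Nat.iter k phi z) ^ 2) by (apply pow_lt; lra).
    apply Rmult_le_reg_r with (Cmod (a - Nat.iter k phi z) ^ 2); [assumption|].
    unfold Rdiv at 1. rewrite Rmult_assoc, Rinv_l, Rmult_1_r by lra.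
    apply Rle_trans with (kappa / 2 * (d / 2) ^ 2); [|apply Rmult_le_compat_l; lra].
    nra. }
  assert (Hbig : kappa <= Re (f z0)).
  { rewrite Ef by assumption. rewrite Ea.
    assert (Hne0 := poisson_denominator a z0 Ha Hz0). apply Cmod_gt_0 in Hne0.
    assert (T : Cmod (a - z0) <= 3).
    { eapply Rle_trans; [apply Cmod_triangle|]. rewrite Cmod_opp. lra. }
    assert (T2 : Cmod (a - z0) ^ 2 <= 9) by nra.
    assert (Hp : 0 < Cmod (a - z0) ^ 2) by now apply pow_lt.
    apply Rmult_le_reg_r with (Cmod (a - z0) ^ 2); [assumption|].
    unfold Rdiv at 1. rewrite (Rmult_assoc _ (/ Cmod (a - z0) ^ 2)), Rinv_l, Rmult_1_r by lra.
    apply Rle_trans with (kappa * 9); [apply Rmult_le_compat_l; lra|].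
    unfold kappa. nra. }
  destruct (mean_ergodic_averages Hme f z (kappa / 2)) as (n & Hn & H).
  - right. exact (Hz O).
  - lra.
  (* The means have real part at most [kappa / 2] and the value at [z0] at least [kappa], so they
     cannot be closer than [kappa / 2]. *)
  - assert (B := Re_cesaro_le _ _ Hsmall n Hn).
    assert (R1 := re_le_Cmod (RtoC (/ INR n) * sum_n_m (fun m => f (Nat.iter m phi z)) 1 n - f z0)%C).
    assert (R2 := Rle_lt_trans _ _ _ R1 H). apply Rabs_lt_between in R2.
    change (Re (?u - ?v)%C) with (Re u - Re v) in R2. lra.
Qed.

Lemma mean_ergodic_orbits_enter : mean_ergodic C_phi ->
  forall z, closed_disc z -> exists m, open_disc (Nat.iter m phi z).
Proof.
  intros Hme z Hz. apply NNPP. intros Hno.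
  assert (Horb : forall k, Cmod (Nat.iter k phi z) = 1).
  { intros k. destruct (iter_closed phi phi_closed k z Hz) as [H|H]; [|assumption].
    exfalso. apply Hno. now exists k. }
  destruct (boundary_fixed_point phi phi_closed phi_open z0 z0_DW z0_in
    (mean_ergodic_circle_invariant Hme z Horb)) as (w & Hw & Hfix).
  exact (mean_ergodic_no_boundary_fixed_point Hme w Hw Hfix).
Qed.

Lemma orbits_enter_uniformly_mean_ergodic :
  (forall z, closed_disc z -> exists m, open_disc (Nat.iter m phi z)) ->
  uniformly_mean_ergodic C_phi.
Proof.
  intros Hent. exists (evaluation_operator z0 z0_in). intros eps.
  assert (Heps := cond_pos eps). assert (Hz0 := open_disc_closed z0 z0_in).
  assert (Hin : Cmod z0 < 1) by exact z0_in.
  (* Half the distance from [z0] to the circle, as [da_Lipschitz] requires; [K] is then a common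
     Lipschitz constant near [z0] for the unit ball. *)
  set (rho := (1 - Cmod z0) / 2). assert (Hrho : 0 < rho) by (unfold rho; lra).
  set (K := 4 * 1 / rho). assert (HK : 0 < K) by (unfold K; apply Rdiv_lt_0_compat; lra).
  destruct (uniform_attraction phi phi_closed z0 z0_DW Hent (Rmin rho (eps / 4 / K)))
    as [N HN].
  { apply Rmin_case; [assumption|]. apply Rdiv_lt_0_compat; lra. }
  (* Values of [f] differ by at most 2 on the unit ball; [M] is chosen so that the first [N] terms
     contribute at most [eps / 4]. *)
  destruct (nfloor_ex (2 * INR N / (eps / 4))) as [M [_ HM]].
  { apply Rmult_le_pos; [|left; apply Rinv_0_lt_compat; lra].
    assert (PN := pos_INR N). lra. }
  exists (S M). intros n Hn.
  (* Each [f] gives only a weak bound and the operator norm is a supremum; aiming at [eps / 2]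
     recovers the strict inequality. *)
  apply Rbar_le_lt_trans with (eps / 2); [|simpl; lra].
  apply (proj2 (Lub_Rbar_correct _)). intros r [f [Hf ->]].
  change (sup_norm (f : disc_algebra) <= 1) in Hf.
  apply (sup_norm_le (minus (cesaro_mean C_phi n f) (evaluation z0 f : da_NormedModule) : disc_algebra)).
  intros z Hz.
  assert (Hc : forall m, closed_disc (Nat.iter m phi z)) by (intros; now apply iter_closed).
  assert (B := cesaro_bound (fun m => (f : disc_algebra) (Nat.iter m phi z)) ((f : disc_algebra) z0)
     2 (eps / 4) N ltac:(lra) ltac:(lra)).
  assert (B1 : Cmod (RtoC (/ INR n) * sum_n_m (fun m => (f : disc_algebra) (Nat.iter m phi z)) 1 n
     - (f : disc_algebra) z0)%C <= 2 * INR N / INR n + eps / 4).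
  { apply B; [| |lia].
    - intros m. eapply Rle_trans; [apply Cmod_triangle|]. rewrite Cmod_opp.
      assert (F1 := Cmod_le_sup_norm f _ (Hc m)). assert (F2 := Cmod_le_sup_norm f _ Hz0). lra.
    - intros m Hm. specialize (HN m z Hm Hz).
      assert (L1 := Rlt_le_trans _ _ _ HN (Rmin_l _ _)).
      assert (L2 := Rlt_le_trans _ _ _ HN (Rmin_r _ _)).
      eapply Rle_trans; [apply (da_Lipschitz f z0 rho Hrho); [unfold rho; lra|lra]|].
      apply Rle_trans with (K * (eps / 4 / K)); [|apply Req_le; field; lra].
      apply Rmult_le_compat; [|apply Cmod_ge_0| |lra].
      + assert (F1 := Cmod_le_sup_norm f _ Hz0). assert (F2 := Cmod_ge_0 ((f : disc_algebra) z0)).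
        apply Rmult_le_pos; [lra|left; now apply Rinv_0_lt_compat].
      + unfold K. apply Rmult_le_compat_r; [left; now apply Rinv_0_lt_compat|lra]. }
  assert (Hn' : INR M + 1 <= INR n) by (rewrite <- S_INR; now apply le_INR).
  assert (PM := pos_INR M).
  assert (Hq : 2 * INR N / INR n <= eps / 4).
  { apply Rmult_le_reg_r with (INR n); [lra|].
    unfold Rdiv at 1. rewrite Rmult_assoc, Rinv_l, Rmult_1_r by lra.
    assert (HM' : 2 * INR N < (INR M + 1) * (eps / 4)).
    { replace (2 * INR N) with (2 * INR N / (eps / 4) * (eps / 4)) by (field; lra).
      apply Rmult_lt_compat_r; lra. }
    nra. }
  rewrite <- cesaro_composition in B1 by assumption.
  replace (da_fun (minus (cesaro_mean C_phi n f) (evaluation z0 f : da_NormedModule)) z)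
    with ((cesaro_mean C_phi n f : disc_algebra) z - (f : disc_algebra) z0)%C; [lra|].
  change (da_fun (minus (cesaro_mean C_phi n f) (evaluation z0 f : da_NormedModule)) z)
    with ((cesaro_mean C_phi n f : disc_algebra) z + RtoC (-1) * evaluation z0 f z)%C.
  unfold evaluation, da_const. rewrite da_restrict_eq by assumption.
  replace (RtoC (-1)) with (- (1))%C by (apply injective_projections; simpl; ring). ring.
Qed.

End MeanErgodic.

Lemma filterlim_Cmod (u : nat -> C) (l : C) :
  filterlim u eventually (locally (T := C_UniformSpace) l) <->
  forall eps, 0 < eps -> exists N, forall n, (N <= n)%nat -> Cmod (u n - l) < eps.
Proof.
  split.
  - intros H eps He. apply (H (fun y => Cmod (y - l) < eps)).
    apply locally_Cmod. exists eps. auto.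
  - intros H P HP. apply locally_Cmod in HP. destruct HP as (d & Hd & HP).
    destruct (H d Hd) as [N HN]. exists N. auto.
Qed.

Theorem theoremB2 (phi : disc_algebra)
    (phi_closed : forall z : C, closed_disc z -> closed_disc (phi z))
    (phi_open : forall z : C, open_disc z -> open_disc (phi z))
    (z0 : C) (z0_DW : Denjoy_Wolff_point phi z0) (z0_in : open_disc z0) :
  let C_phi := composition_operator phi phi_closed phi_open in
  (mean_ergodic C_phi <-> uniformly_mean_ergodic C_phi) /\
  (uniformly_mean_ergodic C_phi <->
    (forall z : C, closed_disc z ->
       filterlim (fun n : nat => Nat.iter n phi z) eventually
         (locally (T := C_UniformSpace) z0))).
Proof.
  intros C_phi.
  (* All three conditions are linked through a fourth one: every orbit in the closed disc enters the
     open disc. *)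
  assert (H1 : uniformly_mean_ergodic C_phi -> mean_ergodic C_phi)
    by apply uniformly_mean_ergodic_mean_ergodic.
  assert (H2 : mean_ergodic C_phi ->
    forall z, closed_disc z -> exists m, open_disc (Nat.iter m phi z))
    by exact (mean_ergodic_orbits_enter phi phi_closed phi_open z0 z0_DW z0_in).
  assert (H3 : (forall z, closed_disc z -> exists m, open_disc (Nat.iter m phi z)) ->
    uniformly_mean_ergodic C_phi)
    by exact (orbits_enter_uniformly_mean_ergodic phi phi_closed phi_open z0 z0_DW z0_in).
  split; [split; auto|]. split.
  - intros H z Hz. apply filterlim_Cmod. intros eps He.
    destruct (uniform_attraction phi phi_closed z0 z0_DW (H2 (H1 H)) eps He) as [N HN].
    exists N. auto.
  - intros H. apply H3. intros z Hz.
    specialize (proj1 (filterlim_Cmod _ _) (H z Hz)). intros L. unfold open_disc in *.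
    (* A point closer to [z0] than [1 - Cmod z0] lies in the open disc. *)
    destruct (L (1 - Cmod z0)) as [N HN]; [lra|].
    exists N. specialize (HN N (le_n N)).
    assert (T := Cmod_le_minus (Nat.iter N phi z) z0). lra.
Qed.
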